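(* There are infinitely many primes $p$ such that there exists a $\mathrm{PSL}(2,11)$-transitive $60$-arc in $\mathrm{PG}(4,p)$. Explicitly, for a prime $p$, there is a $\mathrm{PSL}(2,11)$-transitive $60$-arc in $\mathrm{PG}(4,p)$ if and only if either $p \equiv 1 \pmod{11}$ and $p > 11903$, or $p$ is one of $1277,$ $1783,$ $2069,$ $2333,$ $2399,$ $2707,$ $2861,$ $2971,$ $3169,$ $3499,$ $3631,$ $4027,$ $4159,$ $4357,$ $4423,$ $4621,$ $4643,$ $4951,$ $4973,$ $5039,$ $5171,$ $5237,$ $5281,$ $5303,$ $5347,$ $5413,$ $5479,$ $5501,$ $5743,$ $5897,$ $6007,$ $6029,$ $6073,$ $6271,$ $6337,$ $6359,$ $6469,$ $6689,$ $6733,$ $6997,$ $7019,$ $7129,$ $7151,$ $7283,$ $7349,$ $7393,$ $7459,$ $7481,$ $7547,$ $7723,$ $7789,$ $8009,$ $8053,$ $8273,$ $8317,$ $8537,$ $8581,$ $8647,$ $8669,$ $8713,$ $8779,$ $8867,$ $8933,$ $8999,$ $9043,$ $9109,$ $9241,$ $9439,$ $9461,$ $9769,$ $9791,$ $9857,$ $9901,$ $9923,$ $9967,$ $10099,$ $10253,$ $10429,$ $10627,$ $10781,$ $10847,$ $10891,$ $10957,$ $10979,$ $11177,$ $11243,$ $11287,$ $11353,$ $11551,$ $11617.$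
   Context: For a prime power $q$, $\mathrm{PG}(4,q)$ is the projective space whose points are the $1$-dimensional subspaces of $\mathrm{GF}(q)^5$. A $k$-arc in $\mathrm{PG}(4,q)$ is a set of $k$ projective points such that no subcollection of $5$ of these points is contained in a hyperplane. A $k$-arc in $\mathrm{PG}(4,q)$ is called $\mathrm{PSL}(2,11)$-transitive if there is a subgroup $G \cong \mathrm{PSL}(2,11)$ of $\mathrm{PGL}(5,q)$, arising from a $5$-dimensional irreducible representation of $\mathrm{PSL}(2,11)$ over $\mathrm{GF}(q)$, such that the $k$-arc is $G$-invariant and $G$ acts transitively on its $k$ points. *)

(* Defs.v *)
From HB Require Import structures.
From mathcomp Require Import all_boot all_order all_algebra.
From mathcomp Require Import all_fingroup all_solvable all_field all_character.

Set Implicit Arguments.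
Unset Strict Implicit.
Unset Printing Implicit Defensive.

Import GRing.Theory.
Local Open Scope ring_scope.

Section SpecialLinear.

Variables (n : nat) (F : finFieldType).

Definition SLset : {set {'GL_n[F]}} := [set g | \det (val g) == 1].

Fact SLset_group_set : group_set SLset.
Proof.
apply/group_setP; split=> [|g h]; rewrite !inE ?det1 //.
by move=> /eqP dg /eqP dh; rewrite [val _]GL_ME det_mulmx dg dh mulr1.
Qed.

Definition SLgroup : {group {'GL_n[F]}} := Group SLset_group_set.

Definition PSLgroup := (SLgroup / 'Z(SLgroup))%G.

End SpecialLinear.

(* The ambient group of PGL(n, F), i.e., the full group of this finGroupType:  *)
(* the centre of GL is normal, so every coset is one of the quotient group.    *)
Notation PGLtype n F := (coset_of 'Z('GL_n[F])%g).

Section FiniteSubspaces.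

Variables (F : finFieldType) (vT : vectType F).

Import VectorInternalTheory.

HB.instance Definition _ := [Countable of {vspace vT} by <:].
HB.instance Definition _ := [Finite of {vspace vT} by <:].

End FiniteSubspaces.

Section ProjectiveSpace.

Variable F : finFieldType.

Local Notation subspace := {vspace 'rV[F]_5}.

(* GL acts on row vectors from the right, following the library convention for *)
(* matrix representations.                                                     *)
Definition subspace_act (U : subspace) (g : {'GL_5[F]}) : subspace :=
  (linfun (mulmxr (GLval g : 'M[F]_5)) @: U)%VS.

Fact subspace_act1 : subspace_act^~ 1%g =1 id.
Proof.
move=> U; rewrite /subspace_act (_ : linfun _ = \1%VF) ?lim1g //.
by apply/lfunP=> v; rewrite !lfunE /= mulmx1.
Qed.

Fact subspace_actM U : act_morph subspace_act U.
Proof.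
move=> g h; rewrite /subspace_act -limg_comp; congr (_ @: _)%VS.
by apply/lfunP=> v; rewrite comp_lfunE !lfunE /= mulmxA.
Qed.

Canonical subspace_action := TotalAction subspace_act1 subspace_actM.

(* The library's (to %% H) lets a coset of H act through any representative on *)
(* the H-fixed elements, and trivially on the others; here the acting centre   *)
(* consists of scalar matrices, which fix every subspace (see PGL_actionE). *)
Definition PGL_action := (subspace_action %% 'Z('GL_5[F]))%act.

Lemma GL5_center_scalar (z : {'GL_5[F]}) :
  z \in 'Z('GL_5[F])%g -> exists2 a : F, a != 0 & GLval z = a%:M.
Proof.
move=> /centerP[_ zc].
have E (i j : 'I_5) : i != j -> GLval z *m delta_mx i j = delta_mx i j *m GLval z.
  move=> ij.
  have N2 : (delta_mx i j : 'M[F]_5) *m delta_mx i j = 0.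
    by rewrite mul_delta_mx_0 // eq_sym.
  have u : (1%:M + delta_mx i j : 'M[F]_5) \in unitmx.
    have: (1%:M + delta_mx i j : 'M[F]_5) *m (1%:M - delta_mx i j) = 1%:M.
      by rewrite mulmxDl !mulmxBr N2 mul1mx !mulmx1 mul1mx subr0 subrK.
    by case/mulmx1_unit.
  have := zc (insubd (1%g : {'GL_5[F]}) (1%:M + delta_mx i j)) (in_setT _).
  move/(congr1 GLval); rewrite !GL_ME.
  have -> : GLval (insubd (1%g : {'GL_5[F]}) (1%:M + delta_mx i j)) = 1%:M + delta_mx i j.
    by have := @val_insubd _ _ {'GL_5[F]} (1%g : {'GL_5[F]}) (1%:M + delta_mx i j); rewrite /= => ->; rewrite u.
  rewrite -!mulmxE mulmxDr mulmxDl mulmx1 mul1mx => /addrI. by [].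
have H (k i j : 'I_5) : i != j -> GLval z k i = (k == i)%:R * GLval z j j.
  move=> ij; have /matrixP/(_ k j) := E i j ij.
  rewrite !mxE (bigD1 i) //= big1 => [|l li]; last by rewrite !mxE (negPf li) mulr0.
  rewrite mxE !eqxx mulr1 addr0 => ->.
  rewrite (bigD1 j) //= big1 => [|l li]; last by rewrite !mxE (negPf li) andbF mul0r.
  by rewrite mxE !eqxx andbT addr0.
exists (GLval z ord0 ord0).
  apply/eqP => z0; have := GL_det z; case/negP; apply/eqP.
  rewrite (expand_det_row _ ord0) big1 // => i _.
  case: (eqVneq i ord0) => [->|i0]; first by rewrite z0 mul0r.
  by rewrite (H _ _ _ i0) z0 mulr0 mul0r.
apply/matrixP=> k i; rewrite mxE.
case: (eqVneq i ord0) => [->|i0].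
  case: (eqVneq k ord0) => [->//|k0].
  have k0' : ord0 != k by rewrite eq_sym. by rewrite (H k ord0 k k0') (negPf k0) mul0r mulr0n.
by rewrite (H _ _ _ i0) mulr_natl.
Qed.

Lemma PGL_actionE (U : subspace) (g : {'GL_5[F]}) :
  PGL_action U (coset _ g) = subspace_act U g.
Proof.
have nZ : g \in 'N('Z('GL_5[F]))%g.
  by apply: (subsetP (normal_norm (center_normal 'GL_5[F]%G))); rewrite inE.
rewrite /= (modactE _ nZ) ?in_setT //.
apply/afixP => z /setIP[_ /GL5_center_scalar[a a0 ze]] /=; rewrite /subspace_act.
have -> : linfun (mulmxr (GLval z : 'M[F]_5)) = (a *: \1%VF : 'End('rV[F]_5)).
  by apply/lfunP => v; rewrite scale_lfunE !lfunE /= ze mul_mx_scalar.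
apply/eqP; rewrite eqEdim; apply/andP; split.
  apply/subvP => v /memv_imgP[u uU ->]; rewrite scale_lfunE lfunE /=; exact: memvZ.
rewrite limg_dim_eq //; apply/eqP; rewrite -subv0; apply/subvP => v; rewrite memv_cap memv_ker => /andP[_].
by rewrite scale_lfunE lfunE /= scaler_eq0 (negPf a0) /= memv0.
Qed.

Definition PG4_point (U : subspace) := \dim U == 1%N.

Definition PG4_hyperplane (U : subspace) := \dim U == 4%N.

Definition is_arc (k : nat) (A : {set subspace}) : Prop :=
  [/\ {in A, forall P, PG4_point P}, #|A| = k &
      forall S : {set subspace}, S \subset A -> #|S| = 5%N ->
        ~ exists2 H, PG4_hyperplane H & {in S, forall P, P <= H}%VS].

Definition proj_image (gT : finGroupType) (H : {group gT})
    (rH : mx_representation F H 5) : {group PGLtype 5 F} :=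
  ((reprGLm rH @* H) / 'Z('GL_5[F]))%G.

Definition PSL211_transitive (A : {set subspace}) : Prop :=
  exists G : {group PGLtype 5 F},
    [/\ (G \isog PSLgroup 2 'F_11)%g,
        exists2 rH : mx_representation F (PSLgroup 2 'F_11) 5,
          mx_irreducible rH & G = proj_image rH,
        [acts G, on A | PGL_action] &
        [transitive G, on A | PGL_action]].

End ProjectiveSpace.

Definition exceptional_primes : seq nat := [::
  1277; 1783; 2069; 2333; 2399; 2707; 2861; 2971; 3169; 3499; 3631; 4027;
  4159; 4357; 4423; 4621; 4643; 4951; 4973; 5039; 5171; 5237; 5281; 5303;
  5347; 5413; 5479; 5501; 5743; 5897; 6007; 6029; 6073; 6271; 6337; 6359;
  6469; 6689; 6733; 6997; 7019; 7129; 7151; 7283; 7349; 7393; 7459; 7481;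
  7547; 7723; 7789; 8009; 8053; 8273; 8317; 8537; 8581; 8647; 8669; 8713;
  8779; 8867; 8933; 8999; 9043; 9109; 9241; 9439; 9461; 9769; 9791; 9857;
  9901; 9923; 9967; 10099; 10253; 10429; 10627; 10781; 10847; 10891; 10957;
  10979; 11177; 11243; 11287; 11353; 11551; 11617]%N.

(* Main.v *)
From Stdlib Require Import ZArith.
Require Import Defs.
From mathcomp Require Import all_boot all_order all_algebra.
From mathcomp Require Import all_fingroup all_solvable all_field all_character.
From mathcomp Require Import ssrZ zify ring.

Set Implicit Arguments.
Unset Strict Implicit.
Unset Printing Implicit Defensive.

Import GRing.Theory.
Local Open Scope ring_scope.

(** Let z be a primitive 11th root of unity in a field F.  The Weil
    representation of SL(2,11) on the odd functions from F_11 to F has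
    dimension 5, and minus the identity acts trivially, so it is a
    representation of PSL(2,11).  A unipotent subgroup of order 11 fixes the
    point spanned by the first unit vector, and the orbit of this point has one
    element for each nonzero row vector of F_11^2 up to sign, hence 60 elements
    ([point_vec], [point_vec_weil]).

    This orbit is an arc iff any five point vectors are independent.  The group
    SL(2,11) moves point vectors by the Weil matrices, and diag(1/k,1) moves
    them by the conjugation z |-> z^k ([point_vec_galois]).  Five nonzero
    vectors of F_11^2, distinct up to sign, either lie on a line, and then the
    point vectors are a basis up to scalars, or can be moved by GL(2,11) so that
    two of them become (0,1) and (1,0) ([five_points_independent]).  For each
    choice of the other three, the determinant is an element of Z[z] that does
    not depend on the field.  The norms from Q(z) to Q of these 30856
    elements are computed ([norms], [norm_check]).  Their prime divisors are among
    2, 3, 5, 11, 43, 109 and the 51 members of [bad_primes], the largest of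
    which is 11903, and every bad prime does occur.  So for p = 1 mod 11
    there is an arc as soon as p is not bad ([weil_orbit_arc]), and the
    primes p = 1 mod 11 up to 11903 that are not bad are those listed as
    exceptional ([small_bad]).

    Conversely, let A be an arc of 60 points on which PSL(2,11) acts
    transitively through a representation of degree 5 over F_p.  Since
    60 = 5 mod 11, an element u of order 11 fixes a point of A, spanned by an
    eigenvector v of u whose eigenvalue z satisfies z^11 = 1.  The stabiliser of
    this point has order 11, so the points of A again correspond to the nonzero
    rows up to sign.  The translates of v under the diagonal torus span five
    points of A, hence form a basis, in which the torus and the unipotent
    subgroup act by the Weil matrices.  These matrices determine the whole
    representation ([weil_unique]): the first row of the matrix of the
    Weyl element solves a linear system whose determinant has norm 11^14.
    Thus F_p contains a primitive 11th root of unity, p = 1 mod 11, and A is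
    projectively the Weil orbit, for z and for all its conjugates
    ([arc_root]).  For a bad prime one of the conjugates of some determinant
    vanishes ([bad_det_eq0]), so a bad p has no arc.

    The primes p = 1 mod 11 are unbounded because they include the prime divisors
    of 1 + m + ... + m^10 for m = 11 N! ([infinite_primes_mod11]). *)

(** * Characters and Gauss sums of the field with 11 elements *)

Notation F11 := 'F_11.

(** Quantification over F_11 becomes a boolean computation on the representatives
    0, ..., 10. *)
Lemma F11_check1 (P : pred F11) :
  all (fun n => P (inZp n)) (iota 0 11) -> forall x, P x.
Proof.
move=> /allP h x; have := h x; rewrite mem_iota /= ltn_ord => /(_ isT).
by rewrite valZpK.
Qed.

Lemma F11_check2 (P : F11 -> F11 -> bool) :
  all (fun m => all (fun n => P (inZp m) (inZp n)) (iota 0 11)) (iota 0 11) ->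
  forall x y, P x y.
Proof.
by move=> h x; apply: F11_check1; move: x; apply: F11_check1.
Qed.

Definition nonsq (a : F11) : bool := (a : nat) \notin [:: 1; 3; 4; 5; 9]%N.

Lemma nonsqM (a b : F11) : a != 0 -> b != 0 ->
  nonsq (a * b) = nonsq a (+) nonsq b.
Proof.
move=> a0 b0; apply/eqP; move: a b a0 b0.
suff: forall a b : F11, [|| a == 0, b == 0 | nonsq (a * b) == nonsq a (+) nonsq b].
  by move=> h a b /negPf a0 /negPf b0; have := h a b; rewrite a0 b0.
by apply: F11_check2; vm_compute.
Qed.

Lemma nonsqP (a : F11) : a != 0 ->
  exists2 s : F11, s != 0 & a = (if nonsq a then - 1 else 1) * s ^+ 2.
Proof.
move=> a0.
have h (x : F11) : (x == 0) || has (fun n => (inZp n != 0 :> F11) &&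
   (x == (if nonsq x then - 1 else 1) * (inZp n) ^+ 2)) (iota 1 5).
  by move: x; apply: F11_check1; vm_compute.
by have := h a; rewrite (negPf a0) => /hasP[n _ /andP[n0 /eqP e]]; exists (inZp n).
Qed.

Section Weil.

Variables (F : fieldType) (z : F).
Hypotheses (z11 : z ^+ 11 = 1) (z1 : z != 1).

Definition psi (j : F11) : F := z ^+ j.

Lemma psi_nat n : psi n%:R = z ^+ n.
Proof. by rewrite /psi Zp_nat /= (expr_mod n z11). Qed.

Lemma psi0 : psi 0 = 1. Proof. by rewrite /psi expr0. Qed.

Lemma psiD : {morph psi : x y / x + y >-> x * y}.
Proof. by move=> x y; rewrite /psi -exprD /= (expr_mod _ z11). Qed.

Lemma psiMn x n : psi (x *+ n) = psi x ^+ n.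
Proof. by elim: n => [|n IH]; rewrite ?psi0 // mulrS psiD IH exprS. Qed.

Lemma psi_neq0 x : psi x != 0.
Proof.
apply: expf_neq0; apply/eqP=> z0; move: z11; rewrite z0 expr0n /= => /eqP.
by rewrite eq_sym oner_eq0.
Qed.

Lemma psi_eq1 x : (psi x == 1) = (x == 0).
Proof.
apply/eqP/eqP=> [h|->]; last exact: psi0.
apply/eqP/negPn/negP=> x0; case/eqP: z1.
have: psi (x * x^-1) = 1.
  by rewrite -[x^-1]natr_Zp mulr_natr psiMn h expr1n.
by rewrite divff // /psi /= expr1.
Qed.

Lemma root_expr k : (z ^+ k) ^+ 11 = 1.
Proof. by rewrite -exprM mulnC exprM z11 expr1n. Qed.

Lemma root_expr_neq1 k : k%:R != 0 :> F11 -> z ^+ k != 1.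
Proof. by rewrite -psi_nat psi_eq1. Qed.

Lemma psi_inj : injective psi.
Proof.
move=> x y h; apply/eqP; rewrite -subr_eq0 -psi_eq1; apply/eqP.
apply: (mulIf (psi_neq0 y)); by rewrite -psiD subrK mul1r.
Qed.

Lemma sum_F11 (h : F11 -> F) : \sum_y h y = \sum_(0 <= i < 11) h i%:R.
Proof.
by rewrite big_mkord; apply: eq_bigr => i _; rewrite natr_Zp.
Qed.

Lemma sum_root_powers : \sum_(0 <= i < 11) z ^+ i = 0.
Proof.
apply/eqP; have/eqP := subrX1 z 11; rewrite z11 subrr eq_sym mulf_eq0 subr_eq0.
by rewrite (negPf z1) /= big_mkord.
Qed.

(** In characteristic 11 the Frobenius map is injective, so that 1 would be the
    only 11th root of unity. *)
Lemma eleven_neq0 : 11%:R != 0 :> F.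
Proof.
apply/eqP => e; case/eqP: z1.
have c : 11%N \in [pchar F] by rewrite inE /= e eqxx.
have /eqP: (z - 1) ^+ 11 = 0.
  by rewrite -(pFrobenius_autE c) rmorphB /= !pFrobenius_autE z11 expr1n subrr.
by rewrite expf_eq0 /= subr_eq0 => /eqP.
Qed.

Lemma sum_psi a : \sum_j psi (a * j) = if a == 0 then 11%:R else 0.
Proof.
case: eqVneq => [->|a0].
  rewrite (eq_bigr (fun=> 1)) => [|j _]; last by rewrite mul0r psi0.
  by rewrite sumr_const card_ord.
rewrite -(reindex_inj (h := *%R a) (P := xpredT) (F := psi)); last exact: mulfI.
rewrite sum_F11 -[RHS]sum_root_powers; apply: eq_bigr => i _; exact: psi_nat.
Qed.

(** The quadratic Gauss sum. *)
Definition gsum : F := \sum_y psi (y ^+ 2).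

Lemma gsumE : gsum = 1 + 2%:R * (z + z ^+ 3 + z ^+ 4 + z ^+ 5 + z ^+ 9).
Proof.
transitivity (\sum_(0 <= i < 11) z ^+ (i ^ 2 %% 11)).
  rewrite /gsum sum_F11; apply: eq_bigr => i _.
  by rewrite -natrX psi_nat (expr_mod _ z11).
by rewrite unlock /=; ring.
Qed.

(** The square is -11 because -1 is not a square modulo 11; as a polynomial
    identity, [gsum ^+ 2 + 11] is a multiple of 1 + z + ... + z^10. *)
Lemma gsum_sqr : gsum ^+ 2 = - 11%:R.
Proof.
have := sum_root_powers; rewrite unlock /= => e.
apply/eqP; rewrite -subr_eq0 opprK gsumE; apply/eqP.
(* The cofactor is the quotient of the polynomial in z by
   1 + z + ... + z^10. *)
rewrite -[RHS](mulr0 (12%:R - 8%:R * z + 8%:R * z ^+ 4 - 4%:R * z ^+ 7 + 4%:R * z ^+ 8)) -e.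
ring.
Qed.

Lemma gsum_neq0 : gsum != 0.
Proof.
have: gsum ^+ 2 != 0 by rewrite gsum_sqr oppr_eq0 eleven_neq0.
by rewrite expf_eq0.
Qed.

(** The Legendre symbol, except for its value -1 at 0, which makes it invertible
    everywhere. *)
Definition chi (a : F11) : F := (-1) ^+ nonsq a.

Lemma chiM a b : a != 0 -> b != 0 -> chi (a * b) = chi a * chi b.
Proof. by move=> a0 b0; rewrite /chi nonsqM // signr_addb. Qed.

Lemma chiN a : a != 0 -> chi (- a) = - chi a.
Proof. by move=> a0; rewrite -mulN1r chiM // /chi /= expr1 mulN1r. Qed.

Lemma chi_sqr a : chi a * chi a = 1.
Proof. by rewrite /chi -signr_addb addbb. Qed.

Lemma chiV a : a != 0 -> chi a^-1 = chi a.
Proof.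
move=> a0; have := chi_sqr a; have -> : 1 = chi a * chi a^-1.
  by rewrite -chiM ?invr_eq0 // divff.
by move/(congr1 ( *%R (chi a))); rewrite !mulrA chi_sqr !mul1r.
Qed.

Lemma chi_neq0 a : chi a != 0. Proof. by rewrite signr_eq0. Qed.

(** The values of y^2 and of -y^2 together cover every element of F_11 twice. *)
Lemma gsumN : \sum_y psi (- y ^+ 2) = - gsum.
Proof.
apply/eqP; rewrite -addr_eq0 addrC; apply/eqP.
transitivity (\sum_(0 <= i < 11) (z ^+ (i ^ 2 %% 11) + z ^+ (10 * i ^ 2 %% 11))).
  rewrite /gsum -big_split /= sum_F11; apply: eq_bigr => i _.
  have -> : - (i%:R ^+ 2) = (10 * i ^ 2)%:R :> F11.
    by rewrite natrM natrX -mulN1r; congr (_ * _); apply: val_inj.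
  by rewrite -natrX !psi_nat !(expr_mod _ z11).
transitivity (2%:R * \sum_(0 <= i < 11) z ^+ i); last by rewrite sum_root_powers mulr0.
by rewrite unlock /=; ring.
Qed.

Lemma gauss_square a : a != 0 -> \sum_y psi (a * y ^+ 2) = chi a * gsum.
Proof.
move=> a0; case: (nonsqP a0) => s s0; rewrite /chi.
have re (f : F11 -> F) : \sum_y f (s * y) = \sum_y f y.
  by rewrite -(reindex_inj (mulfI s0) (P := xpredT) (F := f)).
case: (nonsq a) => ->; rewrite ?expr1 ?expr0.
  rewrite [RHS]mulN1r -gsumN -[RHS](re (fun y => psi (- y ^+ 2))).
  by apply: eq_bigr => y _; congr (psi _); ring.
rewrite [RHS]mul1r -[RHS](re (fun y => psi (y ^+ 2))).
by apply: eq_bigr => y _; congr (psi _); ring.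
Qed.

(** Complete the square. *)
Lemma gauss_quadratic a b : a != 0 ->
  \sum_y psi (a * y ^+ 2 + 2%:R * b * y) = psi (- b ^+ 2 / a) * (chi a * gsum).
Proof.
move=> a0; rewrite -gauss_square // mulr_sumr.
rewrite (reindex_inj (addIr (- (b / a)))) /=; apply: eq_bigr => y _.
rewrite -psiD; congr (psi _); field; exact: a0.
Qed.
End Weil.

(** * The Weil matrices of SL(2,11) *)

Definition mx2 (R : Type) (a b c d : R) : 'M[R]_2 :=
  \matrix_(i, j) if i == 0 then (if j == 0 then a else b)
                 else (if j == 0 then c else d).

Lemma mx2E (R : Type) (g : 'M[R]_2) : g = mx2 (g 0 0) (g 0 1) (g 1 0) (g 1 1).
Proof.
apply/matrixP=> i j; rewrite mxE.
by case: i => [[|[|//]] i]; case: j => [[|[|//]] j]; rewrite -?val_eqE /=;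
   congr (g _ _); apply: val_inj.
Qed.

Lemma mulmx2 (R : comNzRingType) (a b c d a' b' c' d' : R) :
  mx2 a b c d *m mx2 a' b' c' d' =
  mx2 (a * a' + b * c') (a * b' + b * d') (c * a' + d * c') (c * b' + d * d').
Proof.
apply/matrixP=> i j; rewrite !mxE !big_ord_recl big_ord0 !mxE /= addr0.
by case: eqP; case: eqP.
Qed.

Lemma det_mx2 (R : comNzRingType) (a b c d : R) : \det (mx2 a b c d) = a * d - b * c.
Proof.
rewrite (expand_det_row _ 0) !big_ord_recl big_ord0 /cofactor !det_mx11 !mxE /=.
by rewrite expr0 expr1; ring.
Qed.

Lemma mx2_1 (R : comNzRingType) : mx2 1 0 0 1 = 1%:M :> 'M[R]_2.
Proof.
by apply/matrixP=> i j; rewrite !mxE; case: i => [[|[|//]] i]; case: j => [[|[|//]] j].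
Qed.

(** The usual generators of SL(2,11): the Weil matrices of the unipotent elements
    are diagonal, and those of the torus are monomial. *)
Definition unipotent (j : F11) : 'M[F11]_2 := mx2 1 j 0 1.
Definition weyl : 'M[F11]_2 := mx2 0 1 (-1) 0.
Definition torus (a : F11) : 'M[F11]_2 := mx2 a 0 0 a^-1.

(** Representatives 1, ..., 5 of the nonzero elements of F_11 up to sign; an odd
    function is known from its values there. *)
Definition half_point (i : 'I_5) : F11 := i.+1%:R.

Section Weil.

Variables (F : fieldType) (z : F).
Hypotheses (z11 : z ^+ 11 = 1) (z1 : z != 1).

Local Notation psi := (psi z).
Local Notation chi := (chi F).
Local Notation gsum := (gsum z).

(** The kernel of the Weil representation on all functions, antisymmetrised in y
    so as to act on odd functions.  For c = 0 it is a monomial operator; for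
    c != 0 it is a Gaussian kernel normalised by the Gauss sum. *)
Definition weil_kernel (g : 'M[F11]_2) (x y : F11) : F :=
  let: (a, b, c, d) := (g 0 0, g 0 1, g 1 0, g 1 1) in
  if c == 0 then chi a * psi (a * b * x ^+ 2) * ((y == a * x)%:R - (y == - (a * x))%:R)
  else gsum^-1 * chi c * psi ((a * x ^+ 2 + d * y ^+ 2) / c)
       * (psi (- (2%:R * x * y / c)) - psi (2%:R * x * y / c)).

Definition weil g : 'M[F]_5 := \matrix_(i, j) weil_kernel g (half_point i) (half_point j).

Lemma weil_kernel_mx2 a b c d x y : weil_kernel (mx2 a b c d) x y =
  if c == 0 then chi a * psi (a * b * x ^+ 2) * ((y == a * x)%:R - (y == - (a * x))%:R)
  else gsum^-1 * chi c * psi ((a * x ^+ 2 + d * y ^+ 2) / c)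
       * (psi (- (2%:R * x * y / c)) - psi (2%:R * x * y / c)).
Proof. by rewrite /weil_kernel !mxE. Qed.

Lemma weil_kernelNr g x y : weil_kernel g x (- y) = - weil_kernel g x y.
Proof.
rewrite [g]mx2E !weil_kernel_mx2; case: ifP => _.
  by rewrite eqr_opp eqr_oppLR -[RHS]mulrN opprB.
by rewrite sqrrN mulrN mulNr opprK -[RHS]mulrN opprB.
Qed.

Lemma weil_kernel0r g x : weil_kernel g x 0 = 0.
Proof.
rewrite [g]mx2E weil_kernel_mx2; case: ifP => _.
  by rewrite eq_sym (eq_sym 0 (- _)) oppr_eq0 subrr mulr0.
by rewrite mulr0 mul0r oppr0 subrr mulr0.
Qed.

Lemma sum_half (h : F11 -> F) :
  \sum_(i < 5) (h (half_point i) + h (- half_point i)) + h 0 = \sum_y h y.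
Proof.
have hn (i j : nat) : (i + j = 11)%N -> - (i%:R) = j%:R :> F11.
  move=> e; apply/eqP; rewrite eq_sym -addr_eq0 addrC -natrD e; exact/eqP/val_inj.
rewrite sum_F11 -(big_mkord xpredT (fun i => h (i.+1%:R) + h (- (i.+1%:R)))).
rewrite unlock /= (hn 1 10)%N // (hn 2 9)%N // (hn 3 8)%N // (hn 4 7)%N // (hn 5 6)%N //.
ring.
Qed.

(** Summing an odd function against h over F_11 is the same as summing it over
    the half points against the odd part of h (without the factor 1/2).  Products
    of Weil matrices thereby become character sums over all of F_11. *)
Lemma sum_half_odd (f h : F11 -> F) : (forall y, f (- y) = - f y) -> f 0 = 0 ->
  \sum_i f (half_point i) * (h (half_point i) - h (- half_point i)) = \sum_y f y * h y.
Proof.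
move=> fN f0; rewrite -sum_half f0 mul0r addr0; apply: eq_bigr => i _.
by rewrite fN mulrBr mulNr.
Qed.

Lemma weil_mul_half g (h : F11 -> F11 -> F) (B : 'M_5) :
  (forall i j, B i j = h (half_point i) (half_point j) - h (- half_point i) (half_point j)) ->
  forall i j, (weil g *m B) i j = \sum_y weil_kernel g (half_point i) y * h y (half_point j).
Proof.
move=> hB i j; rewrite mxE -(sum_half_odd (fun y => h y (half_point j))
  (weil_kernelNr g _) (weil_kernel0r g _)).
by apply: eq_bigr => k _; rewrite mxE hB.
Qed.

Lemma sum_delta (f : F11 -> F) a : \sum_y f y * (a == y)%:R = f a.
Proof.
rewrite (bigD1 a) //= eqxx mulr1 big1 ?addr0 // => y /negPf ya.
by rewrite eq_sym ya mulr0.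
Qed.

Lemma chi1 : chi 1 = 1. Proof. by rewrite /chi expr0. Qed.

Lemma weil_mul_unipotent g j : \det g = 1 -> weil g *m weil (unipotent j) = weil (g *m unipotent j).
Proof.
move=> dg; apply/matrixP => i k.
rewrite (weil_mul_half _ (h := fun y t => psi (j * y ^+ 2) * (t == y)%:R)); last first.
  by move=> {}i {}k; rewrite mxE weil_kernel_mx2 eqxx chi1 !mul1r sqrrN -mulrBr.
under eq_bigr do rewrite mulrA.
rewrite sum_delta mxE; move: (half_point i) (half_point k) => x t.
move: dg; rewrite [g]mx2E; move: (g 0 0) (g 0 1) (g 1 0) (g 1 1) => a b c d.
rewrite det_mx2 mulmx2 => dg; rewrite !weil_kernel_mx2 !mulr1 !mulr0 !addr0.
case: eqVneq => [c0|c0].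
  case: (eqVneq t (a * x)) => [->|t1].
    rewrite mulrAC -!mulrA; congr (_ * _); rewrite mulrA -(psiD z11).
    by congr (psi _ * _); ring.
  case: (eqVneq t (- (a * x))) => [->|t2]; last by rewrite !subr0 !mulr0 mul0r.
  rewrite mulrAC -!mulrA; congr (_ * _); rewrite mulrA -(psiD z11).
  by congr (psi _ * _); ring.
rewrite mulrAC -!mulrA; congr (_ * (_ * _)); rewrite mulrA -(psiD z11).
by congr (psi _ * _); field.
Qed.

(** A product of two kernels is a Gaussian sum over y.  For c = 0 the first kernel
    is a combination of delta functions; for c != 0 the sum is geometric if
    d = 0 and is a quadratic Gauss sum otherwise. *)
Lemma weil_mul_weyl g : \det g = 1 -> weil g *m weil weyl = weil (g *m weyl).
Proof.
move=> dg; apply/matrixP => i k.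
rewrite (weil_mul_half _ (h := fun y t => - gsum^-1 * psi (2%:R * t * y))); last first.
  move=> {}i {}k; rewrite mxE weil_kernel_mx2 oppr_eq0 oner_eq0 chiN ?oner_neq0 // chi1.
  rewrite mulrN1 !mul0r addr0 mul0r (psi0 z) mulr1 -mulrBr; congr (_ * _).
  by rewrite invrN1; congr (psi _ - psi _); ring.
rewrite mxE; move: (half_point i) (half_point k) => x t.
move: dg; rewrite [g]mx2E; move: (g 0 0) (g 0 1) (g 1 0) (g 1 1) => a b c d.
rewrite det_mx2 mulmx2 => dg; rewrite !mulr0 !mulr1 !mulrN1 !addr0 !add0r.
rewrite [RHS]weil_kernel_mx2.
case: (eqVneq c 0) => [c0|c0].
  rewrite c0 mulr0 subr0 in dg; have a0 : a != 0.
    by apply/eqP=> a0; move/eqP: dg; rewrite a0 mul0r eq_sym oner_eq0.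
  have d0 : d != 0 by apply/eqP=> d0; move/eqP: dg; rewrite d0 mulr0 eq_sym oner_eq0.
  have da : d^-1 = a by rewrite -[LHS]mul1r -dg mulfK.
  rewrite oppr_eq0 (negPf d0) c0; under eq_bigr do rewrite weil_kernel_mx2 eqxx.
  rewrite (eq_bigr (fun y => - (gsum^-1 * chi a * psi (a * b * x ^+ 2)) *
      psi (2%:R * t * y) * (a * x == y)%:R + (gsum^-1 * chi a * psi (a * b * x ^+ 2)) *
      psi (2%:R * t * y) * (- (a * x) == y)%:R)); last first.
    by move=> y _; rewrite ![_ == y]eq_sym; ring.
  rewrite big_split /= !sum_delta.
  rewrite chiN // -(chiV _ d0) da invrN da mul0r addr0.
  set q := psi (a * b * _); have -> : psi (- b * x ^+ 2 * - a) = q.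
    by rewrite /q; congr (psi _); ring.
  have -> : - (2%:R * x * t * - a) = 2%:R * t * (a * x) by ring.
  have -> : (2%:R * x * t * - a) = 2%:R * t * - (a * x) by ring.
  ring.
have E : \sum_y weil_kernel (mx2 a b c d) x y * (- gsum^-1 * psi (2%:R * t * y)) =
   - (gsum^-1 ^+ 2) * chi c * psi (a * x ^+ 2 / c) * (
     \sum_y psi (d / c * y ^+ 2 + 2%:R * (t - x / c) * y)
     - \sum_y psi (d / c * y ^+ 2 + 2%:R * (t + x / c) * y)).
  rewrite mulrBr !mulr_sumr -sumrB; apply: eq_bigr => y _.
  rewrite weil_kernel_mx2 (negPf c0).
  have -> : (a * x ^+ 2 + d * y ^+ 2) / c = a * x ^+ 2 / c + d / c * y ^+ 2 by ring.
  have -> : d / c * y ^+ 2 + 2%:R * (t - x / c) * y =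
    d / c * y ^+ 2 + (- (2%:R * x * y / c) + 2%:R * t * y) by ring.
  have -> : d / c * y ^+ 2 + 2%:R * (t + x / c) * y =
    d / c * y ^+ 2 + (2%:R * x * y / c + 2%:R * t * y) by ring.
  by rewrite !(psiD z11); ring.
rewrite {}E; have [d0|d0] := eqVneq d 0.
  rewrite d0 oppr0 eqxx mul0r.
  have bc : - b = c^-1.
    by apply: (mulIf c0); rewrite mulVf // mulNr -dg d0 mulr0 sub0r.
  have e (s : F11) : \sum_y psi (0 * y ^+ 2 + 2%:R * (t + s) * y) = 11%:R * (t == - s)%:R.
    under eq_bigr do rewrite mul0r add0r.
    rewrite (sum_psi z11 z1) mulf_eq0 /= addr_eq0.
    by case: eqP; rewrite ?mulr1 ?mulr0.
  rewrite !e opprK bc chiV // exprVn (gsum_sqr z11 z1).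
  have -> : c^-1 * a * x ^+ 2 = a * x ^+ 2 / c by ring.
  have -> : c^-1 * x = x / c by ring.
  by field; rewrite oppr_eq0 (eleven_neq0 z11 z1).
have dc0 : d / c != 0 by rewrite mulf_neq0 // invr_eq0.
rewrite oppr_eq0 (negPf d0) !(gauss_quadratic z11 z1 _ dc0) chiM ?invr_eq0 // chiV // chiN //.
set r1 := psi (a * x ^+ 2 / c); set s1 := psi (_ / _); set s2 := psi (_ / _).
set t0 := psi (_ / - d); set t1 := psi (- _); set t2 := psi _.
(* Completing the square has produced the phases s1, s2; they match those
   of the product because a d - b c = 1. *)
have e1 : r1 * s1 = t0 * t1.
  rewrite -!(psiD z11); congr psi.
  have -> : b = (a * d - 1) / c by rewrite -dg; field.
  by field; rewrite c0 d0 oppr_eq0 d0.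
have e2 : r1 * s2 = t0 * t2.
  rewrite -!(psiD z11); congr psi.
  have -> : b = (a * d - 1) / c by rewrite -dg; field.
  by field; rewrite c0 d0 oppr_eq0 d0.
transitivity (- (gsum^-1 ^+ 2) * gsum * (chi c * chi c) * chi d * (r1 * s1 - r1 * s2)); first by ring.
rewrite e1 e2 chi_sqr; field; exact: gsum_neq0.
Qed.
End Weil.

(** * Multiplicativity, and the sixty point vectors *)

Lemma det_unipotent j : \det (unipotent j) = 1.
Proof. by rewrite det_mx2; ring. Qed.

Lemma det_weyl : \det weyl = 1.
Proof. by rewrite det_mx2; ring. Qed.

Lemma det_torus a : a != 0 -> \det (torus a) = 1.
Proof. by move=> a0; rewrite det_mx2; field. Qed.

(** A matrix of determinant 1 with c != 0 is a product of two
    upper unipotent factors around a lower unipotent one, and the latter is a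
    conjugate of an upper unipotent matrix by the Weyl element. *)
Lemma sl2_ind (P : 'M[F11]_2 -> Prop) :
  P 1%:M ->
  (forall g j, \det g = 1 -> P g -> P (g *m unipotent j)) ->
  (forall g, \det g = 1 -> P g -> P (g *m weyl)) ->
  forall g, \det g = 1 -> P g.
Proof.
move=> P1 Pu Pw.
pose Q g := \det g = 1 /\ P g.
have Q1 : Q 1%:M by split; rewrite ?det1.
have Qu g j : Q g -> Q (g *m unipotent j).
  by move=> [d p]; split; [rewrite det_mulmx d det_unipotent mulr1|exact: Pu].
have Qw g : Q g -> Q (g *m weyl).
  by move=> [d p]; split; [rewrite det_mulmx d det_weyl mulr1|exact: Pw].
have Qc g : \det g = 1 -> g 1 0 != 0 -> Q g.
  rewrite [g]mx2E; move: (g 0 0) (g 0 1) (g 1 0) (g 1 1) => a b c d.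
  rewrite mxE /= det_mx2 => dg c0.
  suff -> : mx2 a b c d = 1%:M *m unipotent ((a - 1) / c) *m weyl *m weyl *m weyl
      *m unipotent (- c) *m weyl *m unipotent ((d - 1) / c).
    by apply/Qu/Qw/Qu/Qw/Qw/Qw/Qu.
  rewrite -mx2_1 !mulmx2; congr mx2; try by field.
  have -> : b = (a * d - 1) / c by rewrite -dg; field.
  by field.
move=> g dg; suff [] : Q g by [].
have [c0|] := eqVneq (g 1 0) 0; last exact: Qc.
have -> : g = g *m weyl *m weyl *m weyl *m weyl.
  rewrite -!mulmxA; have -> : weyl *m (weyl *m (weyl *m weyl)) = 1%:M.
    by rewrite -mx2_1 !mulmx2; congr mx2; ring.
  by rewrite mulmx1.
(* If c = 0, multiplication by the Weyl element makes c nonzero. *)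
apply/Qw/Qw/Qw/Qc; first by rewrite det_mulmx dg det_weyl mulr1.
move: dg c0; rewrite [g]mx2E; move: (g 0 0) (g 0 1) (g 1 0) (g 1 1) => a b c d.
rewrite mulmx2 !mxE /= det_mx2 => dg c0; apply/eqP=> e; move/eqP: dg.
have -> : d = - (c * 0 + d * -1) by rewrite c0; ring.
by rewrite e c0 oppr0 !mulr0 subr0 eq_sym oner_eq0.
Qed.

Section Weil.

Variables (F : fieldType) (z : F).
Hypotheses (z11 : z ^+ 11 = 1) (z1 : z != 1).

Local Notation psi := (psi z).
Local Notation chi := (chi F).
Local Notation gsum := (gsum z).
Local Notation weil := (weil z).

Lemma half_point_eq i j : (half_point i == half_point j) = (i == j).
Proof.
apply/idP/idP=> [|/eqP->//]; rewrite /half_point -!val_eqE /= !val_Zp_nat //.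
by case: i => [[|[|[|[|[|]]]]]] //; case: j => [[|[|[|[|[|]]]]]].
Qed.

Lemma half_point_eqN i j : (half_point i == - half_point j) = false.
Proof.
by rewrite /half_point; case: i => [[|[|[|[|[|]]]]]] //; case: j => [[|[|[|[|[|]]]]]].
Qed.

Lemma half_point_neq0 i : half_point i != 0.
Proof. by rewrite /half_point; case: i => [[|[|[|[|[|]]]]]]. Qed.

Lemma half_pointP (y : F11) : y != 0 -> exists i, y = half_point i \/ y = - half_point i.
Proof.
move=> y0.
have: (y == 0) || has (fun n => (y == n.+1%:R) || (y == - n.+1%:R)) (iota 0 5).
  by move: y {y0}; apply: F11_check1; vm_compute.
rewrite (negPf y0) => /hasP[n]; rewrite mem_iota => /= n5 /orP e.
by exists (Ordinal n5); case: e => /eqP; [left|right].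
Qed.

Lemma half_point0 : half_point 0 = 1.
Proof. by []. Qed.

Lemma weil1 : weil 1%:M = 1%:M.
Proof.
apply/matrixP=> i j; rewrite -mx2_1 !mxE weil_kernel_mx2 eqxx chi1 !mul1r.
by rewrite half_point_eq half_point_eqN subr0 eq_sym.
Qed.

(** Multiplicativity follows from the cases of generators as second factor. *)
Lemma weilM g h : \det g = 1 -> \det h = 1 -> weil (g *m h) = weil g *m weil h.
Proof.
move=> dg; move: h; apply: sl2_ind.
- by rewrite weil1 !mulmx1.
- move=> h j dh IH; rewrite mulmxA -!weil_mul_unipotent ?IH ?mulmxA //.
  by rewrite det_mulmx dg dh mulr1.
- move=> h dh IH; rewrite mulmxA -!weil_mul_weyl ?IH ?mulmxA //.
  by rewrite det_mulmx dg dh mulr1.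
Qed.

Lemma weil_unit g : \det g = 1 -> weil g \in unitmx.
Proof.
move=> dg; have u : g \in unitmx by rewrite unitmxE dg unitr1.
have /mulmx1_unit[] // : weil g *m weil (invmx g) = 1%:M.
by rewrite -weilM ?mulmxV ?weil1 // det_inv dg invr1.
Qed.

(** Up to a nonzero scalar this is the first row of the Weil matrix of any g
    whose second row is (a, b), see [row0_weil]: a delta function if a = 0, and
    otherwise an odd function with Gaussian phase. *)
Definition point_fun (a b y : F11) : F :=
  if a == 0 then (y == b^-1)%:R - (y == - b^-1)%:R
  else psi (b / a * y ^+ 2) * (psi (2%:R * y / a) - psi (- (2%:R * y / a))).

Definition point_vec (v : 'rV[F11]_2) : 'rV[F]_5 := \row_j point_fun (v 0 0) (v 0 1) (half_point j).

Definition weil_scale (g : 'M[F11]_2) : F :=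
  if g 1 0 == 0 then chi (g 0 0) * psi (g 0 0 * g 0 1)
  else - (gsum^-1 * chi (g 1 0) * psi (g 0 0 / g 1 0)).

Lemma weil_scale_neq0 g : weil_scale g != 0.
Proof.
rewrite /weil_scale; case: ifP => _.
  by rewrite mulf_neq0 ?chi_neq0 ?psi_neq0.
by rewrite oppr_eq0 !mulf_neq0 ?invr_eq0 ?chi_neq0 ?psi_neq0 ?gsum_neq0.
Qed.

(** Multiplying g on the left by a unipotent matrix multiplies the first row of its
    Weil matrix by a scalar, so that the line spanned by this row depends
    on the second row of g alone. *)
Lemma row0_weil g : \det g = 1 -> row 0 (weil g) = weil_scale g *: point_vec (row 1 g).
Proof.
move=> dg; apply/rowP=> j; rewrite !mxE half_point0; move: (half_point j) dg => y.
rewrite [g]mx2E /weil_scale !mxE /=; move: (g 0 0) (g 0 1) (g 1 0) (g 1 1) => a b c d.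
rewrite det_mx2 weil_kernel_mx2 /point_fun expr1n !mulr1 => dg.
have [c0|c0] := eqVneq c 0.
  suff -> : d^-1 = a by [].
  have d0 : d != 0.
    by apply/eqP=> d0; move/eqP: dg; rewrite d0 c0 !mulr0 subr0 eq_sym oner_eq0.
  by rewrite -[LHS]mul1r -dg c0 mulr0 subr0 mulfK.
have -> : (a + d * y ^+ 2) / c = a / c + d / c * y ^+ 2 by ring.
by rewrite (psiD z11); ring.
Qed.

(** SL(2,11) acts transitively on nonzero row vectors. *)
Lemma complete_row1 v : v != 0 :> 'rV[F11]_2 -> exists2 g, \det g = 1 & row 1 g = v.
Proof.
move=> v0; have [a0|a0] := eqVneq (v 0 0) 0; last first.
  exists (mx2 0 (- (v 0 0)^-1) (v 0 0) (v 0 1)); first by rewrite det_mx2; field.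
  by apply/rowP=> j; rewrite !mxE /=; case: j => [[|[|//]] j];
    rewrite -?val_eqE /=; congr (v _ _); apply: val_inj.
have b0 : v 0 1 != 0.
  apply: contraNneq v0 => b0; apply/eqP/rowP=> j; rewrite mxE.
  by case: j => [[|[|//]] j]; [rewrite -a0|rewrite -b0]; congr (v _ _); apply: val_inj.
exists (mx2 (v 0 1)^-1 0 (v 0 0) (v 0 1)); first by rewrite det_mx2 a0; field.
by apply/rowP=> j; rewrite !mxE /=; case: j => [[|[|//]] j];
    rewrite -?val_eqE /=; congr (v _ _); apply: val_inj.
Qed.

Lemma row1_neq0 (g : 'M[F11]_2) : \det g = 1 -> row 1 g != 0.
Proof.
rewrite [g]mx2E det_mx2 => dg; apply/eqP=> /rowP e; move: dg.
have := e 0; have := e 1; rewrite !mxE /= => -> ->; rewrite !mulr0 subrr => /eqP.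
by rewrite eq_sym oner_eq0.
Qed.

(** Both sides are first rows of Weil matrices, of h g for any h whose second
    row is v. *)
Lemma point_vec_weil v g : v != 0 -> \det g = 1 ->
  exists2 s, s != 0 & point_vec v *m weil g = s *: point_vec (v *m g).
Proof.
move=> v0 dg; have [h dh <-] := complete_row1 v0.
exists ((weil_scale h)^-1 * weil_scale (h *m g)); first by rewrite mulf_neq0 ?invr_eq0 ?weil_scale_neq0.
rewrite -row_mul -scalerA -row0_weil ?det_mulmx ?dh ?dg ?mulr1 //.
rewrite weilM // row_mul row0_weil // -scalemxAl scalerA mulVf ?weil_scale_neq0 //.
by rewrite scale1r.
Qed.

Lemma point_vecN v : point_vec (- v) = - point_vec v.
Proof.
apply/rowP=> j; rewrite !mxE /point_fun oppr_eq0; case: ifP => _.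
  by rewrite invrN opprK opprB.
by rewrite invrN !mulrN !mulNr !opprK -[RHS]mulrN opprB.
Qed.

End Weil.

Lemma psiX (F : fieldType) (z : F) k j : z ^+ 11 = 1 -> psi (z ^+ k) j = psi z (k%:R * j).
Proof. by move=> z11; rewrite mulr_natl psiMn // /psi -!exprM mulnC. Qed.

(** Conjugating z by z |-> z^k replaces the character psi by psi(k x), which amounts
    to scaling the first coordinate of v; this extends the symmetry from
    SL(2,11) to GL(2,11). *)
Lemma point_vec_galois (F : fieldType) (z : F) k (v : 'rV_2) :
  z ^+ 11 = 1 -> k%:R != 0 :> F11 ->
  point_vec (z ^+ k) v = point_vec z (v *m mx2 (k%:R)^-1 0 0 1).
Proof.
move=> z11 k0; apply/rowP=> j; rewrite !mxE !big_ord_recl !big_ord0 !mxE /=.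
have -> : lift ord0 ord0 = 1 :> 'I_2 by apply: val_inj.
rewrite !mulr0 !addr0 mulr1 add0r /point_fun mulf_eq0 invr_eq0 (negPf k0) orbF.
have [//|a0] := eqVneq (v 0 0) 0.
by rewrite !psiX //; congr (psi _ _ * (psi _ _ - psi _ _)); field; rewrite a0 k0.
Qed.

(** * Computing determinants and norms over the 11th roots of unity *)

Local Close Scope ring_scope.
Local Open Scope Z_scope.

(** Elements of Z[X]/(X^11 - 1), by coefficients; flat tuples of binary integers
    keep the evaluation of several ten thousand determinants fast. *)
Definition cyc : Type := Z * Z * Z * Z * Z * Z * Z * Z * Z * Z * Z.

Definition czero : cyc := (0, 0, 0, 0, 0, 0, 0, 0, 0, 0, 0).
Definition cone : cyc := (1, 0, 0, 0, 0, 0, 0, 0, 0, 0, 0).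

Definition cadd (a b : cyc) : cyc :=
  let: (x0, x1, x2, x3, x4, x5, x6, x7, x8, x9, x10) := a in
  let: (y0, y1, y2, y3, y4, y5, y6, y7, y8, y9, y10) := b in
  (x0 + y0, x1 + y1, x2 + y2, x3 + y3, x4 + y4, x5 + y5, x6 + y6,
   x7 + y7, x8 + y8, x9 + y9, x10 + y10).

Definition csub (a b : cyc) : cyc :=
  let: (x0, x1, x2, x3, x4, x5, x6, x7, x8, x9, x10) := a in
  let: (y0, y1, y2, y3, y4, y5, y6, y7, y8, y9, y10) := b in
  (x0 - y0, x1 - y1, x2 - y2, x3 - y3, x4 - y4, x5 - y5, x6 - y6,
   x7 - y7, x8 - y8, x9 - y9, x10 - y10).

(** Multiplication by X. *)
Definition crot (a : cyc) : cyc :=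
  let: (x0, x1, x2, x3, x4, x5, x6, x7, x8, x9, x10) := a in
  (x10, x0, x1, x2, x3, x4, x5, x6, x7, x8, x9).

(** Signed sums of powers of X; (true, k) stands for -X^k.  All matrix entries
    have at most two terms. *)
Definition sparse := seq (bool * nat).

Definition smul (e : sparse) (a : cyc) : cyc :=
  foldr (fun t acc => let: (s, k) := t in
           let b := ssrnat.iter k crot a in if s then csub acc b else cadd acc b) czero e.

(** Elements of the real subfield of Q(z), in the basis
    theta_k = z^k + z^-k for k = 1, ..., 5, whose sum is -1. *)
Definition rcyc : Type := Z * Z * Z * Z * Z.

(** The product rule is theta_i theta_j = theta_(i+j) + theta_(i-j), where
    theta_0 = 2 is rewritten as -2 (theta_1 + ... + theta_5). *)
Definition rmul (a b : rcyc) : rcyc :=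
  let: (a1, a2, a3, a4, a5) := a in let: (b1, b2, b3, b4, b5) := b in
  let p11 := a1 * b1 in let p12 := a1 * b2 in let p13 := a1 * b3 in
  let p14 := a1 * b4 in let p15 := a1 * b5 in
  let p21 := a2 * b1 in let p22 := a2 * b2 in let p23 := a2 * b3 in
  let p24 := a2 * b4 in let p25 := a2 * b5 in
  let p31 := a3 * b1 in let p32 := a3 * b2 in let p33 := a3 * b3 in
  let p34 := a3 * b4 in let p35 := a3 * b5 in
  let p41 := a4 * b1 in let p42 := a4 * b2 in let p43 := a4 * b3 in
  let p44 := a4 * b4 in let p45 := a4 * b5 in
  let p51 := a5 * b1 in let p52 := a5 * b2 in let p53 := a5 * b3 in
  let p54 := a5 * b4 in let p55 := a5 * b5 in
  let s := p11 + p22 + p33 + p44 + p55 in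
  let t := s + s in
  (p12 + p21 + p23 + p32 + p34 + p43 + p45 + p54 + p55 - t,
   p11 + p13 + p24 + p31 + p35 + p42 + p45 + p53 + p54 - t,
   p12 + p14 + p21 + p25 + p35 + p41 + p44 + p52 + p53 - t,
   p13 + p15 + p22 + p25 + p31 + p34 + p43 + p51 + p52 - t,
   p14 + p15 + p23 + p24 + p32 + p33 + p41 + p42 + p51 - t).

(** The product of an element with its complex conjugate; the constant term s is
    rewritten as -s (theta_1 + ... + theta_5). *)
Definition cabs2 (a : cyc) : rcyc :=
  let: (x0, x1, x2, x3, x4, x5, x6, x7, x8, x9, x10) := a in
  let s := x0 * x0 + x1 * x1 + x2 * x2 + x3 * x3 + x4 * x4 + x5 * x5
    + x6 * x6 + x7 * x7 + x8 * x8 + x9 * x9 + x10 * x10 in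
  (x0 * x1 + x1 * x2 + x2 * x3 + x3 * x4 + x4 * x5 + x5 * x6
    + x6 * x7 + x7 * x8 + x8 * x9 + x9 * x10 + x10 * x0 - s,
   x0 * x2 + x1 * x3 + x2 * x4 + x3 * x5 + x4 * x6 + x5 * x7
    + x6 * x8 + x7 * x9 + x8 * x10 + x9 * x0 + x10 * x1 - s,
   x0 * x3 + x1 * x4 + x2 * x5 + x3 * x6 + x4 * x7 + x5 * x8
    + x6 * x9 + x7 * x10 + x8 * x0 + x9 * x1 + x10 * x2 - s,
   x0 * x4 + x1 * x5 + x2 * x6 + x3 * x7 + x4 * x8 + x5 * x9
    + x6 * x10 + x7 * x0 + x8 * x1 + x9 * x2 + x10 * x3 - s,
   x0 * x5 + x1 * x6 + x2 * x7 + x3 * x8 + x4 * x9 + x5 * x10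
    + x6 * x0 + x7 * x1 + x8 * x2 + x9 * x3 + x10 * x4 - s).

(** The automorphism z |-> z^2, which permutes the basis by
    theta_1 -> theta_2 -> theta_4 -> theta_3 -> theta_5 -> theta_1. *)
Definition rgal (a : rcyc) : rcyc :=
  let: (a1, a2, a3, a4, a5) := a in (a5, a1, a4, a2, a3).

(** The norm to Q: the product of the images under the five powers of [rgal],
    grouped so as to need three multiplications only. *)
Definition rnorm (a : rcyc) : rcyc :=
  let b := rmul a (rgal a) in rmul (rmul b (rgal (rgal b))) (rgal (rgal (rgal (rgal a)))).

Definition rcmp (a b : rcyc) : comparison :=
  let: (a1, a2, a3, a4, a5) := a in let: (b1, b2, b3, b4, b5) := b in
  match a1 ?= b1 with Eq =>
  match a2 ?= b2 with Eq =>
  match a3 ?= b3 with Eq =>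
  match a4 ?= b4 with Eq => a5 ?= b5
  | c => c end | c => c end | c => c end | c => c end.

(** Search trees without balancing, to remove duplicates: the determinants have
    many symmetries, so there are far fewer norms than determinants. *)
Inductive tree := Leaf | Node of tree & rcyc & tree.

Fixpoint tmem (x : rcyc) (t : tree) : bool :=
  if t is Node l y r then
    match rcmp x y with Eq => true | Lt => tmem x l | Gt => tmem x r end
  else false.

Fixpoint tinsert (x : rcyc) (t : tree) : tree :=
  if t is Node l y r then
    match rcmp x y with
    | Eq => t
    | Lt => Node (tinsert x l) y r
    | Gt => Node l y (tinsert x r)
    end
  else Node Leaf x Leaf.

Fixpoint tflat (t : tree) (s : seq rcyc) : seq rcyc :=
  if t is Node l y r then tflat l (y :: tflat r s) else s.

Definition tset (t : tree) : seq rcyc := tflat t [::].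

Fixpoint collect (T : Type) (f : T -> rcyc) (s : seq T) (t : tree) : tree :=
  if s is x :: s' then
    let y := f x in
    if tmem y t then collect f s' t else collect f s' (tinsert y t)
  else t.

Local Close Scope Z_scope.

Fixpoint delete_nth (T : Type) (j : nat) (s : seq T) : seq T :=
  match s, j with
  | [::], _ => [::]
  | _ :: s, 0 => s
  | x :: s, j.+1 => x :: delete_nth j s
  end.

Fixpoint sparse_dot (r : seq sparse) (c : seq cyc) : cyc :=
  match r, c with
  | e :: r, x :: c => cadd (smul e x) (sparse_dot r c)
  | _, _ => czero
  end.

(** The signed maximal minors of an n by n.+1 matrix: by Laplace expansion, the
    determinant of this matrix below a row r is [sparse_dot r] of them.  The
    minors are thus shared by all rows r. *)
Fixpoint cofactors (n : nat) (M : seq (seq sparse)) : seq cyc :=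
  [seq let M' := [seq delete_nth j r | r <- M] in
       let d := match n, M' with n.+1, r :: M'' => sparse_dot r (cofactors n M'') | _, _ => cone end in
       if odd j then csub czero d else d | j <- iota 0 n.+1].

Definition F11inv (a : nat) : nat := nth 0 [:: 0; 1; 6; 4; 3; 9; 2; 8; 7; 5; 10] a.

(** The coordinate of the point vector of v at y, see [point_fun], as an element of
    Z[X]. *)
Definition entry (v : nat * nat) (y : nat) : sparse :=
  let: (a, b) := v in
  if a == 0 then
    if y * b %% 11 == 1 then [:: (false, 0)] else
    if y * b %% 11 == 10 then [:: (true, 0)] else [::]
  else let i := F11inv a in
    [:: (false, (b * i * y * y + 2 * y * i) %% 11); (true, (b * i * y * y + 9 * y * i) %% 11)].

(** The first coordinate is left out because determinants in normal form are
    expanded along the vector of (0, 1), which is the first unit vector. *)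
Definition point_row (v : nat * nat) : seq sparse := [seq entry v y | y <- iota 2 4].

(** One representative of each nonzero row vector of F_11^2 up to sign. *)
Definition half_plane : seq (nat * nat) :=
  [seq (0, b) | b <- iota 1 5] ++ [seq (a, b) | a <- iota 1 5, b <- iota 0 11].

Definition half_rest := [seq v <- half_plane | (v != (0, 1)) && (v != (1, 0))].

(** The minors shared by all last vectors are computed once for each pair. *)
Fixpoint collect_last (a : seq sparse) (rs : seq (seq sparse)) (t : tree) : tree :=
  if rs is b :: rs' then
    let c := cofactors 3 [:: point_row (1, 0); a; b] in
    collect_last a rs' (collect (fun r => cabs2 (sparse_dot r c)) rs' t)
  else t.

Fixpoint collect_triples (rs : seq (seq sparse)) (t : tree) : tree :=
  if rs is a :: rs' then collect_triples rs' (collect_last a rs' t) else t.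

(** The values |d|^2 for d running over the determinants in normal form; the norms
    are taken after duplicates have been removed. *)
Definition keys : tree := collect_triples [seq point_row v | v <- half_rest] Leaf.

Definition norms : seq rcyc := tset (collect rnorm (tset keys) Leaf).

Local Open Scope ring_scope.

Section Soundness.

Variable F : fieldType.

Definition Z_cast (x : Z) : F := (int_of_Z x)%:~R.

Lemma Z_castD x y : Z_cast (Z.add x y) = Z_cast x + Z_cast y.
Proof. by rewrite /Z_cast -[(Z.add x y)]/(x + y) rmorphD /= intrD. Qed.

Lemma Z_castB x y : Z_cast (Z.sub x y) = Z_cast x - Z_cast y.
Proof. by rewrite /Z_cast -[(Z.sub x y)]/(x - y) rmorphB /= rmorphB. Qed.

Lemma Z_castM x y : Z_cast (Z.mul x y) = Z_cast x * Z_cast y.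
Proof. by rewrite /Z_cast -[(Z.mul x y)]/(x * y) rmorphM /= intrM. Qed.

Lemma Z_cast0 : Z_cast Z0 = 0. Proof. by []. Qed.

Lemma Z_cast1 : Z_cast (Zpos xH) = 1. Proof. by []. Qed.

Section Evaluation.
Variable z : F.
Hypothesis z11 : z ^+ 11 = 1.

Definition cyc_eval (a : cyc) : F :=
  let: (x0, x1, x2, x3, x4, x5, x6, x7, x8, x9, x10) := a in
  Z_cast x0 + Z_cast x1 * z + Z_cast x2 * z ^+ 2 + Z_cast x3 * z ^+ 3 + Z_cast x4 * z ^+ 4
  + Z_cast x5 * z ^+ 5 + Z_cast x6 * z ^+ 6 + Z_cast x7 * z ^+ 7
  + Z_cast x8 * z ^+ 8 + Z_cast x9 * z ^+ 9 + Z_cast x10 * z ^+ 10.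

Lemma cyc_evalD a b : cyc_eval (cadd a b) = cyc_eval a + cyc_eval b.
Proof.
case: a => [[[[[[[[[[? ?]?]?]?]?]?]?]?]?]?]; case: b => [[[[[[[[[[? ?]?]?]?]?]?]?]?]?]?].
by rewrite /= !Z_castD; ring.
Qed.

Lemma cyc_evalB a b : cyc_eval (csub a b) = cyc_eval a - cyc_eval b.
Proof.
case: a => [[[[[[[[[[? ?]?]?]?]?]?]?]?]?]?]; case: b => [[[[[[[[[[? ?]?]?]?]?]?]?]?]?]?].
by rewrite /= !Z_castB; ring.
Qed.

Lemma cyc_eval0 : cyc_eval czero = 0.
Proof. by rewrite /cyc_eval /= Z_cast0 !mul0r !addr0. Qed.

Lemma cyc_eval1 : cyc_eval cone = 1.
Proof. by rewrite /cyc_eval /= Z_cast0 Z_cast1 !mul0r !addr0. Qed.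

Lemma cyc_eval_rot a : cyc_eval (crot a) = z * cyc_eval a.
Proof.
case: a => [[[[[[[[[[x0 x1]x2]x3]x4]x5]x6]x7]x8]x9]x10].
by rewrite /= -[Z_cast x10 in LHS]mulr1 -z11; ring.
Qed.

Definition sparse_eval (e : sparse) : F := \sum_(t <- e) (-1) ^+ t.1 * z ^+ t.2.

Lemma cyc_eval_smul e a : cyc_eval (smul e a) = sparse_eval e * cyc_eval a.
Proof.
rewrite /sparse_eval; elim: e => [|[s k] e IH]; first by rewrite big_nil mul0r -cyc_eval0.
have rk : cyc_eval (ssrnat.iter k crot a) = z ^+ k * cyc_eval a.
  by elim: k => [|k IHk] /=; rewrite ?mul1r // cyc_eval_rot IHk mulrA exprS.
rewrite big_cons mulrDl -IH [smul _ _]/=.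
by case: s; rewrite ?cyc_evalB ?cyc_evalD rk ?expr1 ?expr0 /=; ring.
Qed.

Definition sparse_mx n (M : seq (seq sparse)) : 'M[F]_n :=
  \matrix_(i, j) sparse_eval (nth [::] (nth [::] M i) j).

Lemma cyc_eval_dot n r c : size r = n -> size c = n ->
  cyc_eval (sparse_dot r c) = \sum_(i < n) sparse_eval (nth [::] r i) * cyc_eval (nth czero c i).
Proof.
elim: r c n => [|e r IH] [|x c] [|n] //; first by rewrite big_ord0 -cyc_eval0.
by case=> sr [sc]; rewrite [sparse_dot _ _]/= cyc_evalD cyc_eval_smul big_ord_recl /= (IH _ n).
Qed.

Lemma nth_delete_nth (T : Type) (x0 : T) j s k : nth x0 (delete_nth j s) k = nth x0 s (bump j k).
Proof.
elim: s j k => [|x s IH] [|j] [|k] //=; rewrite ?nth_nil // IH.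
by rewrite /bump ltnS; case: leq.
Qed.

Lemma size_delete_nth (T : Type) j (s : seq T) n : (j <= n)%N -> size s = n.+1 ->
  size (delete_nth j s) = n.
Proof. elim: s j n => [|x s IH] [|j] [|n] //= jn [] // sn; by rewrite (IH _ n). Qed.

Lemma size_cofactors n M : size (cofactors n M) = n.+1.
Proof. by case: n => [|n]; rewrite /= ?size_map ?size_iota. Qed.

(** Induction on the size, by expansion along the first row. *)
Lemma cyc_eval_det n r M : size r = n.+1 -> size M = n ->
    (forall i, (i < n)%N -> size (nth [::] M i) = n.+1) ->
  cyc_eval (sparse_dot r (cofactors n M)) = \det (sparse_mx n.+1 (r :: M)).
Proof.
elim: n r M => [|n IH] r M sr sM hM.
  case: M sM {hM} => // _; case: r sr => [|e []] // _.
  rewrite det_mx11 mxE /= cyc_evalD cyc_eval_smul cyc_eval0 addr0.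
  by rewrite cyc_eval1 mulr1.
rewrite (cyc_eval_dot sr) ?size_cofactors // (expand_det_row _ 0); apply: eq_bigr => i _.
rewrite /cofactor mxE /= add0n; congr (_ * _).
rewrite -[_ :: _]/[seq _ | j <- iota 0 n.+2] (nth_map 0%N) ?size_iota // nth_iota //= add0n.
have -> : row' 0 (col' i (sparse_mx n.+2 (r :: M))) = sparse_mx n.+1 [seq delete_nth i r | r <- M].
  by apply/matrixP=> k l; rewrite !mxE /= (nth_map [::]) ?sM // nth_delete_nth.
case: M sM hM => [//|r' M] /= [sM] hM.
have hi : (i <= n.+1)%N by rewrite -ltnS.
have E := IH (delete_nth i r') [seq delete_nth i r | r <- M].
rewrite -{}E ?size_map //.
- set d := sparse_dot _ _; suff:
    cyc_eval (if odd i then csub czero d else d) = (-1) ^+ i * cyc_eval d by [].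
  case: (odd i) (signr_odd F i) => <-; rewrite ?expr0 ?mul1r // expr1 mulN1r.
  by rewrite cyc_evalB cyc_eval0 sub0r.
- exact: (size_delete_nth hi (hM 0%N isT)).
by move=> j jn; rewrite (nth_map [::]) ?sM //; apply: size_delete_nth (hM j.+1 _).
Qed.

Lemma F11invP (n : nat) : (n < 11)%N -> n%:R^-1 = (F11inv n)%:R :> F11.
Proof.
have: all (fun n => n%:R^-1 == (F11inv n)%:R :> F11) (iota 0 11) by vm_compute.
by move=> /allP h n11; apply/eqP/h; rewrite mem_iota.
Qed.

Lemma sparse_eval_entry a b y : (a < 11)%N -> (b < 11)%N -> (0 < y < 6)%N ->
  sparse_eval (entry (a, b) y) = point_fun z a%:R b%:R y%:R.
Proof.
move=> a11 b11 y6.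
have nE (m n : nat) : (m%:R == n%:R :> F11) = (m == n %[mod 11]).
  by rewrite -val_eqE /= !val_Fp_nat.
rewrite /point_fun /entry.
have -> : (a%:R == 0 :> F11) = (a == 0)%N by rewrite (nE a 0%N) mod0n modn_small.
rewrite !F11invP //; have [_|a0] := eqVneq a 0%N.
  have: all (fun b => all (fun y => ((y%:R == (F11inv b)%:R :> F11) == (y * b %% 11 == 1)%N) &&
    ((y%:R == - (F11inv b)%:R :> F11) == (y * b %% 11 == 10)%N)) (iota 1 5)) (iota 0 11).
    by vm_compute.
  move=> /allP H1; have/allP H2 := H1 b (etrans (mem_iota 0 11 b) b11).
  move: (H2 y (etrans (mem_iota 1 5 y) y6)); cbv beta => /andP[/eqP-> /eqP->].
  rewrite /sparse_eval; case: eqP => [->|_].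
    by rewrite big_seq1 /= mul1r subr0.
  by case: eqP => _; rewrite ?big_seq1 ?big_nil /= sub0r ?mulr1 ?oppr0.
rewrite /sparse_eval big_cons big_seq1 /= !expr0 expr1 mul1r mulN1r.
rewrite mulrBr -!(psiD z11) !(expr_mod _ z11) -!(psi_nat z11).
congr (psi _ _ - psi _ _); rewrite natrD !natrM; first by ring.
have -> : 9%:R = - 2%:R :> F11 by apply: val_inj.
ring.
Qed.

Definition theta k : F := z ^+ k + z ^+ (11 - k).

Definition real_eval (a : rcyc) : F :=
  let: (a1, a2, a3, a4, a5) := a in
  Z_cast a1 * theta 1 + Z_cast a2 * theta 2 + Z_cast a3 * theta 3 + Z_cast a4 * theta 4
  + Z_cast a5 * theta 5.

(** Because of this relation constants need no coordinate of their own. *)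
Lemma theta_sum : z != 1 -> theta 1 + theta 2 + theta 3 + theta 4 + theta 5 = -1.
Proof.
move=> z1; have := sum_root_powers z11 z1; rewrite unlock /= => e; apply/eqP.
by rewrite -subr_eq0 opprK -e /theta /=; apply/eqP; ring.
Qed.

Lemma thetaN k : (k <= 11)%N -> theta (11 - k) = theta k.
Proof. by move=> k11; rewrite /theta subKn // addrC. Qed.

Lemma thetaM i j : (j <= i)%N -> (i + j <= 11)%N -> theta i * theta j = theta (i + j) + theta (i - j).
Proof.
move=> ji ij; rewrite /theta mulrDl !mulrDr -!exprD.
have e n : z ^+ (n + 11) = z ^+ n by rewrite exprD z11 mulr1.
have -> : (i + (11 - j) = i - j + 11)%N by lia.
have -> : (11 - i + (11 - j) = 11 - (i + j) + 11)%N by lia.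
have -> : (11 - i + j = 11 - (i - j))%N by lia.
by rewrite !e; ring.
Qed.

Lemma theta0 : theta 0 = 2%:R.
Proof. by rewrite /theta expr0 z11. Qed.

(** After expansion, each product of two theta's is replaced by a sum of two, and
    the constant 2 by a multiple of the sum of all theta's. *)
Lemma real_evalM a b : z != 1 -> real_eval (rmul a b) = real_eval a * real_eval b.
Proof.
move=> z1; have s := theta_sum z1.
have t11 := @thetaM 1 1 isT isT; have t21 := @thetaM 2 1 isT isT; have t31 := @thetaM 3 1 isT isT.
have t41 := @thetaM 4 1 isT isT; have t51 := @thetaM 5 1 isT isT; have t22 := @thetaM 2 2 isT isT.
have t32 := @thetaM 3 2 isT isT; have t42 := @thetaM 4 2 isT isT; have t52 := @thetaM 5 2 isT isT.
have t33 := @thetaM 3 3 isT isT; have t43 := @thetaM 4 3 isT isT; have t53 := @thetaM 5 3 isT isT.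
have t44 := @thetaM 4 4 isT isT; have t54 := @thetaM 5 4 isT isT; have t55 := @thetaM 5 5 isT isT.
have n6 := @thetaN 5 isT; have n7 := @thetaN 4 isT; have n8 := @thetaN 3 isT.
have n9 := @thetaN 2 isT; have n10 := @thetaN 1 isT.
move: t11 t21 t31 t41 t51 t22 t32 t42 t52 t33 t43 t53 t44 t54 t55.
rewrite ![(_ + _)%N]/= ![(_ - _)%N]/= in n6 n7 n8 n9 n10 *.
rewrite n6 n7 n8 n9 n10 theta0.
move: a b => [[[[a1 a2] a3] a4] a5] [[[[b1 b2] b3] b4] b5] /=.
rewrite !(Z_castB, Z_castD, Z_castM).
move: (theta 1) (theta 2) (theta 3) (theta 4) (theta 5) s => h1 h2 h3 h4 h5.
move: (Z_cast a1) (Z_cast a2) (Z_cast a3) (Z_cast a4) (Z_cast a5) => {a1 a2 a3 a4 a5} a1 a2 a3 a4 a5.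
move: (Z_cast b1) (Z_cast b2) (Z_cast b3) (Z_cast b4) (Z_cast b5) => {b1 b2 b3 b4 b5} b1 b2 b3 b4 b5.
move=> s t11 t21 t31 t41 t51 t22 t32 t42 t52 t33 t43 t53 t44 t54 t55.
transitivity (a1 * b1 * (h1 * h1) + (a1 * b2 + a2 * b1) * (h2 * h1)
 + (a1 * b3 + a3 * b1) * (h3 * h1) + (a1 * b4 + a4 * b1) * (h4 * h1)
 + (a1 * b5 + a5 * b1) * (h5 * h1) + a2 * b2 * (h2 * h2) + (a2 * b3 + a3 * b2) * (h3 * h2)
 + (a2 * b4 + a4 * b2) * (h4 * h2) + (a2 * b5 + a5 * b2) * (h5 * h2) + a3 * b3 * (h3 * h3)
 + (a3 * b4 + a4 * b3) * (h4 * h3) + (a3 * b5 + a5 * b3) * (h5 * h3) + a4 * b4 * (h4 * h4)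
 + (a4 * b5 + a5 * b4) * (h5 * h4) + a5 * b5 * (h5 * h5)); last by ring.
rewrite t11 t21 t31 t41 t51 t22 t32 t42 t52 t33 t43 t53 t44 t54 t55.
have -> : 2%:R = - 2%:R * (h1 + h2 + h3 + h4 + h5) by rewrite s; ring.
ring.
Qed.

End Evaluation.

(** theta_k becomes theta_2k, and theta_k = theta_(11-k). *)
Lemma real_eval_gal z a : z ^+ 11 = 1 -> real_eval z (rgal a) = real_eval (z ^+ 2) a.
Proof.
move=> z11; case: a => [[[[a1 a2] a3] a4] a5] /=.
have t k : (k <= 5)%N -> theta (z ^+ 2) k = theta z (2 * k).
  move=> k5; rewrite /theta -!exprM; congr (_ + _).
  have -> : (2 * (11 - k) = 11 - 2 * k + 11)%N by lia.
  by rewrite exprD z11 mulr1.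
rewrite !t // -[(2 * 1)%N]/2%N -[(2 * 2)%N]/4%N -[(2 * 3)%N]/(11 - 5)%N.
rewrite -[(2 * 4)%N]/(11 - 3)%N -[(2 * 5)%N]/(11 - 1)%N !thetaN //; ring.
Qed.

(** Here z^10 = z^-1 is the conjugate of z.  The product is expanded as a sum of
    rotations of the first factor, each of which is linear in its coefficients. *)
Lemma real_eval_cabs2 z a : z ^+ 11 = 1 -> z != 1 ->
  real_eval z (cabs2 a) = cyc_eval z a * cyc_eval (z ^+ 10) a.
Proof.
move=> z11 z1; have s := theta_sum z11 z1.
have r k b : z ^+ k * cyc_eval z b = cyc_eval z (ssrnat.iter k crot b).
  by elim: k => [|k IH] /=; rewrite ?mul1r // (cyc_eval_rot z11) -IH mulrA exprS.
have e n : z ^+ (n + 11) = z ^+ n by rewrite exprD z11 mulr1.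
have p k : (k < 11)%N -> (z ^+ 10) ^+ k.+1 = z ^+ (10 - k).
  move=> k11; rewrite -exprM (_ : 10 * k.+1 = 11 * k + (10 - k))%N; last by lia.
  by rewrite exprD exprM z11 expr1n mul1r.
case: a => [[[[[[[[[[x0 x1]x2]x3]x4]x5]x6]x7]x8]x9]x10].
set a := (x0, x1, x2, x3, x4, x5, x6, x7, x8, x9, x10).
have -> : cyc_eval (z ^+ 10) a = Z_cast x0 * z ^+ 0 + Z_cast x1 * z ^+ 10 + Z_cast x2 * z ^+ 9
  + Z_cast x3 * z ^+ 8 + Z_cast x4 * z ^+ 7 + Z_cast x5 * z ^+ 6 + Z_cast x6 * z ^+ 5 + Z_cast x7 * z ^+ 4
  + Z_cast x8 * z ^+ 3 + Z_cast x9 * z ^+ 2 + Z_cast x10 * z ^+ 1.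
  by rewrite /cyc_eval -[X in Z_cast x1 * X]expr1 !p //= expr0 mulr1.
transitivity (Z_cast x0 * cyc_eval z a
  + Z_cast x1 * cyc_eval z (ssrnat.iter 10 crot a)
  + Z_cast x2 * cyc_eval z (ssrnat.iter 9 crot a)
  + Z_cast x3 * cyc_eval z (ssrnat.iter 8 crot a)
  + Z_cast x4 * cyc_eval z (ssrnat.iter 7 crot a)
  + Z_cast x5 * cyc_eval z (ssrnat.iter 6 crot a)
  + Z_cast x6 * cyc_eval z (ssrnat.iter 5 crot a)
  + Z_cast x7 * cyc_eval z (ssrnat.iter 4 crot a)
  + Z_cast x8 * cyc_eval z (ssrnat.iter 3 crot a)
  + Z_cast x9 * cyc_eval z (ssrnat.iter 2 crot a)
  + Z_cast x10 * cyc_eval z (ssrnat.iter 1 crot a)); last first.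
  by rewrite -!r; move: (cyc_eval z a) => E; ring.
have aux c b1 b2 b3 b4 b5 : (b1 - c) * theta z 1 + (b2 - c) * theta z 2 + (b3 - c) * theta z 3
    + (b4 - c) * theta z 4 + (b5 - c) * theta z 5
    = b1 * theta z 1 + b2 * theta z 2 + b3 * theta z 3 + b4 * theta z 4 + b5 * theta z 5 + c.
  by rewrite -[X in _ = _ + X]opprK -[X in _ = _ - X]mulrN1 -s; ring.
rewrite /= !Z_castB aux !(Z_castD, Z_castM) /theta /=.
move: (Z_cast x0) (Z_cast x1) (Z_cast x2) (Z_cast x3) (Z_cast x4) (Z_cast x5)
  (Z_cast x6) (Z_cast x7) (Z_cast x8) (Z_cast x9) (Z_cast x10).
move=> {a x0 x1 x2 x3 x4 x5 x6 x7 x8 x9 x10} x0 x1 x2 x3 x4 x5 x6 x7 x8 x9 x10.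
ring.
Qed.

(** The exponents are the powers 1, 2, 4, 8, 16 of 2; the last is 5 modulo 11. *)
Lemma real_eval_norm z y : z ^+ 11 = 1 -> z != 1 ->
  real_eval z (rnorm y) = real_eval z y * real_eval (z ^+ 2) y
    * (real_eval (z ^+ 4) y * real_eval (z ^+ 8) y) * real_eval (z ^+ 5) y.
Proof.
move=> z11 z1; rewrite /rnorm !(real_evalM z11 _ _ z1).
have e16 : z ^+ 16 = z ^+ 5 by rewrite -[16%N]/(11 + 5)%N exprD z11 mul1r.
have g k y' : real_eval (z ^+ k) (rgal y') = real_eval (z ^+ (k * 2)) y'.
  by rewrite real_eval_gal ?(root_expr z11) // -exprM.
have g1 y' : real_eval z (rgal y') = real_eval (z ^+ 2) y' by rewrite real_eval_gal.
have m k a b : z ^+ k != 1 -> real_eval (z ^+ k) (rmul a b) =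
    real_eval (z ^+ k) a * real_eval (z ^+ k) b.
  by move=> zk; rewrite real_evalM ?(root_expr z11).
by rewrite !g1 !g (m 4) ?(root_expr_neq1 z11 z1) // !g -[(4 * 2)%N]/8%N -[(4 * 2 * 2)%N]/16%N e16.
Qed.

End Soundness.

(** * The computed list contains the norms of all normal forms *)

Lemma mem_tflat t s : tflat t s =i tset t ++ s.
Proof.
rewrite /tset => x; elim: t s => [|l IHl y r IHr] s //=.
by rewrite IHl !mem_cat (IHl (y :: _)) mem_cat !inE IHr mem_cat -!orbA.
Qed.

Lemma mem_node l y r x : (x \in tset (Node l y r)) = [|| x \in tset l, x == y | x \in tset r].
Proof. by rewrite {1}/tset /= mem_tflat mem_cat inE. Qed.

Lemma rcmp_eq a b : rcmp a b = Eq -> a = b.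
Proof.
case: a b => [[[[a1 a2] a3] a4] a5] [[[[b1 b2] b3] b4] b5] /=.
case: Z.compare_spec => // ->; case: Z.compare_spec => // ->.
by case: Z.compare_spec => // ->; case: Z.compare_spec => // ->; case: Z.compare_spec => // ->.
Qed.

Lemma mem_tinsert x t y : (y \in tset (tinsert x t)) = (y == x) || (y \in tset t).
Proof.
elim: t => [|l IHl z r IHr]; first by rewrite /= mem_node in_nil orbF.
rewrite /=; case E: (rcmp x z); rewrite !mem_node.
- by rewrite (rcmp_eq E); case: eqP; rewrite ?orbT.
- by rewrite IHl -!orbA.
by rewrite IHr; case: (y == x); rewrite ?orbT.
Qed.

(** An element that the search misses is merely inserted again, so the trees
    need no ordering invariant. *)
Lemma tmem_sound x t : tmem x t -> x \in tset t.
Proof.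
elim: t => [//|l IHl z r IHr] /=; rewrite mem_node.
case E: (rcmp x z); first by rewrite (rcmp_eq E) eqxx orbT.
  by move/IHl ->.
by move/IHr ->; rewrite !orbT.
Qed.

Lemma mem_collect (T : eqType) (f : T -> rcyc) s t :
  tset (collect f s t) =i [seq f x | x <- s] ++ tset t.
Proof.
move=> y; elim: s t => [//|x s IH] t /=; case: ifP => [/tmem_sound fx|_]; rewrite IH.
  rewrite inE !mem_cat; case: (y =P f x) => [->|//]; by rewrite fx orbT.
by rewrite inE !mem_cat mem_tinsert !orbA; congr orb; rewrite orbC.
Qed.

(** [cabs2] of the determinant in which row c comes second, after the vector of
    (0, 1) that removes the first coordinate. *)
Definition row_key (a b c : seq sparse) : rcyc :=
  cabs2 (sparse_dot c (cofactors 3 [:: point_row (1, 0)%N; a; b])).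

Lemma mem_collect_last a rs t y : reflect
  (y \in tset t \/ exists b c, subseq [:: b; c] rs /\ y = row_key a b c)
  (y \in tset (collect_last a rs t)).
Proof.
elim: rs t => [|b rs IH] t /=.
  by apply: (iffP idP) => [->|[//|[b [c [//]]]]]; left.
apply: (iffP (IH _)) => [[]|].
- rewrite mem_collect mem_cat => /orP[/mapP[c crs ->]|]; last by left.
  by right; exists b, c; rewrite eqxx sub1seq crs.
- by move=> [b' [c [h ->]]]; right; exists b', c; split=> //;
  apply: subseq_trans h (subseq_cons _ _).
case=> [yt|[b' [c [h ->]]]]; first by left; rewrite mem_collect mem_cat yt orbT.
move: h; case: eqP => [->|_] h; last by right; exists b', c.
by left; rewrite mem_collect mem_cat map_f // -sub1seq.
Qed.

Lemma mem_collect_triples rs t y : reflect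
  (y \in tset t \/ exists a b c, subseq [:: a; b; c] rs /\ y = row_key a b c)
  (y \in tset (collect_triples rs t)).
Proof.
elim: rs t => [|a rs IH] t.
  by apply: (iffP idP) => [->|[//|[a [b [c [//]]]]]]; left.
apply: (iffP (IH _)) => [[/mem_collect_last[]|]|].
- by left.
- by move=> [b [c [h ->]]]; right; exists a, b, c; rewrite /= eqxx.
- by move=> [a' [b [c [h ->]]]]; right; exists a', b, c; split=> //;
  apply: subseq_trans h (subseq_cons _ _).
case=> [yt|[a' [b [c [/= h ->]]]]]; first by left; apply/mem_collect_last; left.
move: h; case: eqP => [->|_] h; last by right; exists a', b, c.
by left; apply/mem_collect_last; right; exists b, c.
Qed.

Definition key_of (a b c : nat * nat) : rcyc := row_key (point_row a) (point_row b) (point_row c).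

Lemma keysP y : reflect
  (exists a b c, subseq [:: a; b; c] half_rest /\ y = key_of a b c) (y \in tset keys).
Proof.
apply: (iffP (mem_collect_triples _ _ _)) => [[//|[a [b [c [h ->]]]]]|].
  case/subseqP: h => m _; rewrite -map_mask.
  move: (mask m half_rest) (mask_subseq m half_rest) => [|a' [|b' [|c' []]]] //= h [-> -> ->].
  by exists a', b', c'.
move=> [a [b [c [h ->]]]]; right; exists (point_row a), (point_row b), (point_row c).
by split=> //; apply: (map_subseq point_row h).
Qed.

Lemma normsP n : reflect
  (exists a b c, subseq [:: a; b; c] half_rest /\ n = rnorm (key_of a b c)) (n \in norms).
Proof.
have E t : tset (collect rnorm t Leaf) =i [seq rnorm y | y <- t].
  by move=> y; rewrite mem_collect cats0.
rewrite /norms E; apply: (iffP mapP) => [[y /keysP[a [b [c [h ->]]]] ->]|].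
  by exists a, b, c.
by move=> [a [b [c [h ->]]]]; exists (key_of a b c); [apply/keysP; exists a, b, c|].
Qed.

Definition pair_row (v : nat * nat) : 'rV[F11]_2 := \row_j if j == 0 then v.1%:R else v.2%:R.

Section PointsMatrix.
Variables (F : fieldType).

Definition points_mx (z : F) (s : seq 'rV[F11]_2) : 'M[F]_5 := \matrix_(i < 5) point_vec z (nth 0 s i).

Variables (z : F).
Hypothesis z11 : z ^+ 11 = 1.

Lemma small_half_plane v : v \in half_plane -> (v.1 < 11)%N && (v.2 < 11)%N.
Proof. by move: v; apply/allP; vm_compute. Qed.

(** In the determinant on the right the vector of (0, 1) is the first unit vector;
    it comes first and c second, so that expansion along these two rows is what the
    computation performs. *)
Lemma cyc_eval_normal a b c : {subset [:: a; b; c] <= half_plane} ->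
  cyc_eval z (sparse_dot (point_row c) (cofactors 3 [:: point_row (1, 0)%N; point_row a; point_row b])) =
  \det (points_mx z [seq pair_row v | v <- [:: (0, 1)%N; c; (1, 0)%N; a; b]]).
Proof.
move=> habc; have sp v : size (point_row v) = 4%N by [].
rewrite (cyc_eval_det z11 (n := 3)) //; last by case=> [|[|[|]]].
rewrite [RHS](expand_det_row _ 0) big_ord_recl big1 ?addr0 => [|i _]; last first.
  rewrite !mxE /= /point_fun eqxx -[1%:R]/1 invr1.
  by case: i => [[|[|[|[|[]]]]]] // i; rewrite [_ - _]subrr mul0r.
rewrite !mxE /= /point_fun eqxx -[1%:R]/1 invr1 half_point0 [_ - _]subr0 mul1r.
rewrite /cofactor expr0 mul1r; congr (\det _); apply/matrixP=> i j; rewrite !mxE /=.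
set s := [:: point_row c; point_row (1, 0)%N; point_row a; point_row b].
have -> : s = [seq point_row v | v <- [:: c; (1, 0)%N; a; b]] by [].
have -> : nth 0 [:: pair_row c; pair_row (1, 0)%N; pair_row a; pair_row b] i =
  pair_row (nth (0, 0)%N [:: c; (1, 0)%N; a; b] i) by case: i => [[|[|[|[]]]]].
have hs : {subset [:: c; (1, 0)%N; a; b] <= half_plane}.
  move=> v; case/predU1P => [->|]; first by apply: habc; rewrite !inE eqxx !orbT.
  case/predU1P => [->|]; first by vm_compute.
  case/predU1P => [->|]; first by apply: habc; rewrite mem_head.
  case/predU1P => [->|//]; by apply: habc; rewrite !inE eqxx orbT.
rewrite (nth_map (0, 0)%N) ?ltn_ord // (nth_map 0%N) ?ltn_ord // nth_iota ?ltn_ord //.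
have /small_half_plane := hs _ (mem_nth (0, 0)%N (ltn_ord i : (i < size [:: c; (1, 0)%N; a; b])%N)).
case: nth => [x y] /andP[x11 y11]; rewrite (sparse_eval_entry z11) ?mxE //=.
by have := ltn_ord j; lia.
Qed.

End PointsMatrix.

(** * Prime divisors of the norms *)

Local Close Scope ring_scope.

Section Numerics.

Local Open Scope Z_scope.

(** The prime divisors congruent to 1 modulo 11 of the norms of determinants in
    normal form. *)
Definition bad_primes : seq Z := [:: 23; 67; 89; 199; 331; 353; 397; 419; 463; 617; 661; 683;
  727; 859; 881; 947; 991; 1013; 1123; 1321; 1409; 1453; 1607; 1871; 2003; 2113; 2179; 2267;
  2311; 2377; 2531; 2663; 2729; 2927; 3037; 3191; 3257; 3301; 3323; 3389; 3433; 3697; 3719;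
  3851; 3917; 4049; 4093; 6491; 7591; 7877; 11903].

Definition divisors_of_norms : seq Z := [:: 2, 3, 5, 11, 43, 109 & bad_primes].

(** A common multiple of all norms.  The exponent 16 suffices for the primes that
    are repeated; the other ones never occur twice in one norm. *)
Definition norm_multiple : Z :=
  foldr (fun q m => q * m) 1 (flatten (nseq 16 [:: 2; 3; 5; 11; 43; 109; 23; 67; 89]) ++ bad_primes).

Definition divides (q n : Z) : bool := n mod q =? 0.

(** A vector with five equal coordinates n represents the rational integer -n.
    The first part bounds the prime divisors of the norms, and the second shows
    that every bad prime divides one of them. *)
Definition norm_check : bool :=
  let ns := norms in
  all (fun n => let: (n1, n2, n3, n4, n5) := n in
    [&& n2 =? n1, n3 =? n1, n4 =? n1, n5 =? n1 & divides n1 norm_multiple]) ns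
  && all (fun q => has (fun n => let: (n1, _, _, _, _) := n in divides q n1) ns) bad_primes.

(** This evaluates the norms of the 30856 determinants in normal form. *)
Lemma norm_checkT : norm_check = true.
Proof. by vm_cast_no_check (erefl true). Qed.

Definition exceptional_check : bool :=
  all (fun p => (p mod 11 =? 1) && all (fun q => ~~ divides p q) divisors_of_norms)
    [seq Z.of_nat p | p <- exceptional_primes].

Lemma exceptional_checkT : exceptional_check = true.
Proof. by vm_cast_no_check (erefl true). Qed.

Lemma exceptionalP (p : nat) : p \in exceptional_primes ->
  Z.of_nat p mod 11 = 1 /\ {in divisors_of_norms, forall q, ~~ divides (Z.of_nat p) q}.
Proof.
move=> pe; have pe' : Z.of_nat p \in [seq Z.of_nat p | p <- exceptional_primes].
  exact: map_f pe.
have := exceptional_checkT; rewrite /exceptional_check => /allP/(_ _ pe')/andP[/Z.eqb_spec h1 h2].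
by split=> // q; apply: (allP h2).
Qed.

(** The primes up to 109; this suffices below 113^2, hence up to 11903. *)
Definition sieve : seq Z := [:: 2; 3; 5; 7; 11; 13; 17; 19; 23; 29; 31; 37; 41; 43; 47; 53;
  59; 61; 67; 71; 73; 79; 83; 89; 97; 101; 103; 107; 109].

(** The numbers 11 k + 1 for k = 1, ..., 1082 end with 11903; each is bad,
    exceptional or composite. *)
Definition small_check : bool :=
  let es := [seq Z.of_nat p | p <- exceptional_primes] in
  all (fun k => let p := Z.of_nat k * 11 + 1 in
    has (Z.eqb p) bad_primes || has (Z.eqb p) es || has (fun d => (d <? p) && divides d p) sieve)
    (iota 1 1082).

Lemma small_checkT : small_check = true.
Proof. by vm_cast_no_check (erefl true). Qed.

Lemma divisors_of_norms_bound q : q \in divisors_of_norms -> 0 < q <= Z.of_nat 11903.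
Proof.
have: all (fun q => (0 <? q) && (q <=? Z.of_nat 11903)) divisors_of_norms by vm_compute.
by move=> /allP h /h /andP[/Z.ltb_spec0 ? /Z.leb_spec0 ?].
Qed.

Lemma le_11903 p : (p <= 11903)%N -> Z.of_nat p <= 11 * 1082 + 1.
Proof.
move=> /leP/inj_le; suff -> : Z.of_nat 11903 = 11 * 1082 + 1 by [].
by vm_compute.
Qed.

End Numerics.

Local Open Scope ring_scope.

(** * When a determinant in normal form vanishes modulo p *)

Lemma Z_cast_nat (F : fieldType) m : Z_cast F (Z.of_nat m) = m%:R.
Proof. by rewrite /Z_cast; have -> : int_of_Z (Z.of_nat m) = m by lia. Qed.

Lemma modn_Z m n : (0 < n)%N -> Z.modulo (Z.of_nat m) (Z.of_nat n) = Z.of_nat (m %% n).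
Proof.
move=> n0; symmetry; apply: (Z.mod_unique_pos _ _ (Z.of_nat (m %/ n))).
  by have := ltn_pmod m n0; lia.
have E := divn_eq m n; rewrite [in LHS]E; lia.
Qed.

Lemma Z_cast_eq0 p x : prime p -> (Z_cast 'F_p x == 0) = divides (Z.of_nat p) x.
Proof.
move=> pp; have p0 := prime_gt0 pp.
have [r rp rE] : exists2 r, (r < p)%N & Z.modulo x (Z.of_nat p) = Z.of_nat r.
  have [|h1 h2] := Z.mod_pos_bound x (Z.of_nat p); first by lia.
  by exists (Z.to_nat (Z.modulo x (Z.of_nat p))); lia.
have -> : x = Z.add (Z.mul (Z.of_nat p) (Z.div x (Z.of_nat p))) (Z.of_nat r).
  by rewrite -rE; apply: Z.div_mod; lia.
rewrite Z_castD Z_castM !Z_cast_nat (pcharf0 (pchar_Fp pp)) mul0r add0r -(dvdn_pcharf (pchar_Fp pp)).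
rewrite /divides Z.add_comm Z.mul_comm Z.mod_add; last by lia.
rewrite Z.mod_small; last by lia.
by case: r rp {rE} => [|r] rp; rewrite ?dvdn0 // gtnNdvd //; lia.
Qed.

(** Because the theta's add up to -1. *)
Lemma real_eval_const (F : fieldType) (z : F) n : z ^+ 11 = 1 -> z != 1 ->
  real_eval z (n, n, n, n, n) = - Z_cast F n.
Proof.
by move=> z11 z1; rewrite /real_eval -!mulrDr (theta_sum z11 z1) mulrN1.
Qed.

(** The order of the rows agrees with the expansion in [cyc_eval_normal]. *)
Definition normal_five (a b c : nat * nat) : seq 'rV[F11]_2 :=
  [seq pair_row v | v <- [:: (0, 1)%N; c; (1, 0)%N; a; b]].

Lemma half_rest_half v : v \in half_rest -> v \in half_plane.
Proof. by rewrite mem_filter => /andP[]. Qed.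

Lemma real_eval_key_of (F : fieldType) (z : F) a b c : z ^+ 11 = 1 -> z != 1 ->
  subseq [:: a; b; c] half_rest ->
  real_eval z (key_of a b c) = \det (points_mx z (normal_five a b c))
    * \det (points_mx (z ^+ 10) (normal_five a b c)).
Proof.
move=> z11 z1 h; have hs : {subset [:: a; b; c] <= half_plane}.
  by move=> v /(mem_subseq h)/half_rest_half.
by rewrite /key_of /row_key real_eval_cabs2 // -(cyc_eval_normal z11 hs)
  -(cyc_eval_normal (root_expr z11 10) hs).
Qed.

Lemma norm_spec a b c : subseq [:: a; b; c] half_rest ->
  exists2 n, rnorm (key_of a b c) = (n, n, n, n, n) &
    divides n norm_multiple.
Proof.
move=> h; have := norm_checkT; rewrite /norm_check => /andP[/allP H _].
have /H : rnorm (key_of a b c) \in norms by apply/normsP; exists a, b, c.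
case: rnorm => [[[[n1 n2] n3] n4] n5] /and5P[/Z.eqb_spec-> /Z.eqb_spec-> /Z.eqb_spec-> /Z.eqb_spec-> d].
by exists n1.
Qed.

(** If the determinant vanishes in F_p then p divides its norm, hence
    [norm_multiple], hence a prime in [divisors_of_norms]; all these are at most
    11903, and none is exceptional. *)
Lemma normal_det_neq0 p (z : 'F_p) a b c : prime p ->
  (11903 < p)%N \/ p \in exceptional_primes ->
  z ^+ 11 = 1 -> z != 1 -> subseq [:: a; b; c] half_rest ->
  \det (points_mx z (normal_five a b c)) != 0.
Proof.
move=> pp hp z11 z1 h; apply/eqP=> d0.
have [n nE dn] := norm_spec h.
have n0 : Z_cast 'F_p n = 0.
  apply: oppr_inj; rewrite oppr0 -(real_eval_const n z11 z1) -nE real_eval_norm // real_eval_key_of // d0.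
  by rewrite !mul0r.
have : Z_cast 'F_p norm_multiple = 0.
  have -> : norm_multiple = Z.mul n (Z.div norm_multiple n).
    apply/Z.div_exact; last exact/Z.eqb_spec.
    move=> n_0; move: dn; rewrite n_0; by vm_compute.
  by rewrite Z_castM n0 mul0r.
have zprod s : Z_cast 'F_p (foldr (fun q m => Z.mul q m) (Zpos xH) s) = \prod_(q <- s) Z_cast 'F_p q.
  elim: s => [|q s IH]; first by rewrite big_nil Z_cast1.
  by rewrite big_cons -IH -Z_castM.
rewrite /norm_multiple zprod => /eqP; rewrite prodf_seq_eq0 => /hasP[q qs /=].
rewrite Z_cast_eq0 // => pq.
have qd : q \in divisors_of_norms.
  by move: q qs {pq}; apply/allP; vm_compute.
case: hp => [big|exc].
  have [q0 q1] := divisors_of_norms_bound qd; have/ltP/inj_lt lt_p := big.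
  have qp := Z.le_lt_trans _ _ _ q1 lt_p.
  move: pq; rewrite /divides Z.mod_small; last by split; [exact: Z.lt_le_incl|].
  by move/Z.eqb_spec => e; rewrite e in q0.
by have [_ /(_ q qd)/negP] := exceptionalP exc.
Qed.

Lemma exceptional_mod11 (p : nat) : p \in exceptional_primes -> p = 1 %[mod 11].
Proof.
move=> /exceptionalP[h _].
have E := etrans (esym h) (@modn_Z p 11 isT); apply: Nat2Z.inj.
by rewrite -E.
Qed.

Lemma small_bad p : prime p -> p = 1 %[mod 11] -> (p <= 11903)%N ->
  p \notin exceptional_primes -> Z.of_nat p \in bad_primes.
Proof.
move=> pp p1 /le_11903 pl pe; have := small_checkT; rewrite /small_check => /allP/(_ (p %/ 11)%N).
have p2 := prime_gt1 pp.
have E := divn_eq p 11; rewrite p1 modn_small // in E.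
have -> : (p %/ 11)%N \in iota 1 1082 by rewrite mem_iota; lia.
move/(_ isT); cbv beta zeta.
have -> : Z.add (Z.mul (Z.of_nat (p %/ 11)) (Z.of_nat 11)) (Zpos xH) = Z.of_nat p by lia.
case/orP=> [/orP[]|] /hasP[q].
- by move=> h /Z.eqb_spec ->.
- by move=> /mapP[m mE ->] /Z.eqb_spec/Nat2Z.inj pm; rewrite pm mE in pe.
move=> qs /andP[/Z.ltb_spec0 qp qd].
have q1 : Z.lt (Zpos xH) q.
  by apply/Z.ltb_spec0; move: q qs {qp qd}; apply/allP; vm_compute.
have [m mE] : exists m, q = Z.of_nat m by exists (Z.to_nat q); lia.
move: qd; rewrite /divides mE => /Z.eqb_spec h.
have : (m %| p)%N by apply/dvdnP; exists (p %/ m)%N; have E2 := divn_eq p m; move: h; rewrite modn_Z; lia.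
by move: pp => /primeP[_ /[apply]] /orP[] /eqP; lia.
Qed.

(** A norm divisible by p vanishes in F_p.  It is a product of the values that the determinant
    takes at powers of z, one of which then vanishes. *)
Lemma bad_det_eq0 p (z : 'F_p) : prime p -> Z.of_nat p \in bad_primes ->
  z ^+ 11 = 1 -> z != 1 ->
  exists a b c, subseq [:: a; b; c] half_rest /\
    exists2 k, k%:R != 0 :> F11 & \det (points_mx (z ^+ k) (normal_five a b c)) = 0.
Proof.
move=> pp pb z11 z1; have := norm_checkT; rewrite /norm_check => /andP[_ /allP/(_ _ pb)].
move=> /hasP[n /normsP[a [b [c [h ->]]]] {n}].
have [n nE _] := norm_spec h; rewrite nE -Z_cast_eq0 // => /eqP n0.
exists a, b, c; split=> //.
have K k : (k%:R != 0 :> F11) -> real_eval (z ^+ k) (key_of a b c) = 0 ->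
  exists2 k, k%:R != 0 :> F11 & \det (points_mx (z ^+ k) (normal_five a b c)) = 0.
  move=> k0; rewrite real_eval_key_of ?(root_expr z11) ?(root_expr_neq1 z11 z1) // => /eqP.
  rewrite mulf_eq0 -exprM => /orP[/eqP|/eqP] d.
    by exists k.
  by exists (k * 10)%N; rewrite // natrM mulf_neq0.
have := real_eval_norm (key_of a b c) z11 z1; rewrite nE (real_eval_const n z11 z1) n0 oppr0 => /esym/eqP.
rewrite !mulf_eq0 -[X in real_eval X]expr1 => /orP[/orP[/orP[]|/orP[]]|] /eqP; exact: K.
Qed.

(** * Reduction of five points to normal form *)

(** Then the row space of B contains the row space of A, which is everything. *)
Lemma det_neq0_span (F : fieldType) n (A B : 'M[F]_n) :
  (forall i, exists j c, row i A = c *: row j B) -> \det A != 0 -> \det B != 0.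
Proof.
rewrite -!unitfE -!unitmxE -!row_full_unit => h.
have : (A <= B)%MS.
  by apply/row_subP => i; have [j [c ->]] := h i; rewrite scalemx_sub ?row_sub.
by move=> /mxrankS; rewrite -!col_leq_rank => /[swap] /leq_trans; apply.
Qed.

Lemma rV2P (u v : 'rV[F11]_2) : reflect (u 0 0 = v 0 0 /\ u 0 1 = v 0 1) (u == v).
Proof.
apply: (iffP eqP) => [->//|[e0 e1]]; apply/rowP=> j.
by case: j => [[|[|//]] j]; [have -> : Ordinal j = 0 by apply: val_inj|
  have -> : Ordinal j = 1 by apply: val_inj].
Qed.

Definition row2 (a b : F11) : 'rV[F11]_2 := \row_j if j == 0 then a else b.

Lemma row2E (v : 'rV[F11]_2) : row2 (v 0 0) (v 0 1) = v.
Proof. by apply/eqP/rV2P; rewrite !mxE. Qed.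

Lemma mul_row2 a b (g : 'M[F11]_2) :
  row2 a b *m g = row2 (a * g 0 0 + b * g 1 0) (a * g 0 1 + b * g 1 1).
Proof.
have e : lift ord0 ord0 = 1 :> 'I_2 by apply: val_inj.
by apply/eqP/rV2P; rewrite !mxE !big_ord_recl !big_ord0 !mxE /= !e !addr0.
Qed.

Lemma half_plane_repr (v : 'rV[F11]_2) : v != 0 ->
  exists2 u, u \in half_plane & v = pair_row u \/ v = - pair_row u.
Proof.
move=> v0.
have : forall a b : F11, (a == 0) && (b == 0) || has (fun u => ((a == u.1%:R) && (b == u.2%:R))
    || ((a == - u.1%:R) && (b == - u.2%:R))) half_plane.
  by apply: F11_check2; vm_compute.
move=> /(_ (v 0 0) (v 0 1))/orP[|/hasP[u hu /orP[]]] /andP[/eqP a /eqP b].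
- by case/negP: v0; apply/rV2P; rewrite !mxE.
- by exists u => //; left; apply/eqP/rV2P; rewrite !mxE.
by exists u => //; right; apply/eqP/rV2P; rewrite !mxE.
Qed.

Lemma pair_row_inj u u' : u \in half_plane -> u' \in half_plane ->
  pair_row u = pair_row u' \/ pair_row u = - pair_row u' -> u = u'.
Proof.
move=> hu hu' e; apply/eqP; move: u hu u' hu' e.
have h : all (fun u => all (fun u' => (u == u') ||
   ~~ ((u.1%:R == u'.1%:R :> F11) && (u.2%:R == u'.2%:R :> F11)) &&
   ~~ ((u.1%:R == - u'.1%:R :> F11) && (u.2%:R == - u'.2%:R :> F11))) half_plane) half_plane.
  by vm_compute.
move=> u /(allP h)/allP hu u' /hu{hu}/orP[//|/andP[n1 n2]] [] /eqP/rV2P; rewrite !mxE /=.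
  by move=> [e1 e2]; rewrite e1 e2 !eqxx in n1.
by move=> [e1 e2]; rewrite e1 e2 !eqxx in n2.
Qed.

(** Distinct as points of the quotient by sign, thus with distinct point vectors
    up to sign. *)
Definition pmdiff (v w : 'rV[F11]_2) := (v != w) && (v != - w).

Lemma pm_eq (x a b : 'rV[F11]_2) : (x == a) || (x == - a) -> (x == b) || (x == - b) ->
  a = b \/ a = - b.
Proof.
by case/orP=> /eqP-> /orP[] /eqP e; [left|right|right; rewrite -e opprK|left; apply: oppr_inj].
Qed.

Lemma pm_trans (x y a : 'rV[F11]_2) : (x == a) || (x == - a) -> (y == a) || (y == - a) ->
  x = y \/ x = - y.
Proof.
by case/orP=> /eqP-> /orP[] /eqP->; rewrite ?opprK; [left|right|right|left].
Qed.

Section Reduction.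

Variable F : fieldType.
Hypothesis normal : forall (z : F) a b c, z ^+ 11 = 1 -> z != 1 ->
  subseq [:: a; b; c] half_rest -> \det (points_mx z (normal_five a b c)) != 0.

Variables (z : F).
Hypotheses (z11 : z ^+ 11 = 1) (z1 : z != 1).

Variable s : seq 'rV[F11]_2.
Hypotheses (s5 : size s = 5%N) (s_pm : pairwise pmdiff s) (s0 : 0 \notin s).

Lemma nth_neq0 i : (i < 5)%N -> nth 0 s i != 0.
Proof. by move=> i5; apply: contraNneq s0 => <-; rewrite mem_nth ?s5. Qed.

Lemma nth_pm_inj i j : (i < 5)%N -> (j < 5)%N ->
  nth 0 s i = nth 0 s j \/ nth 0 s i = - nth 0 s j -> i = j.
Proof.
have h k l : (k < l < 5)%N -> pmdiff (nth 0 s k) (nth 0 s l).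
  by case/andP=> kl l5; move/(pairwiseP 0): s_pm; apply=> //; rewrite !inE s5 // (ltn_trans kl).
move=> i5 j5 e; case: (ltngtP i j) => // ij; exfalso.
  have := h i j; rewrite ij j5 => /(_ isT)/andP[/eqP n1 /eqP n2].
  by case: e.
have := h j i; rewrite ij i5 => /(_ isT)/andP[/eqP n1 /eqP n2].
by case: e => e; [case: n1|case: n2]; rewrite ?e ?opprK.
Qed.

Lemma row_points_mx_weil g (i : 'I_5) : \det g = 1 ->
  exists2 c, c != 0 & row i (points_mx z s *m weil z g) = c *: point_vec z (nth 0 s i *m g).
Proof.
move=> dg; rewrite row_mul rowK.
exact: point_vec_weil z11 z1 _ _ (nth_neq0 (ltn_ord i)) dg.
Qed.

Lemma det_points_mx_weil g : \det g = 1 ->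
  \det (points_mx z s *m weil z g) != 0 -> \det (points_mx z s) != 0.
Proof. by move=> _; rewrite det_mulmx mulf_eq0 negb_or => /andP[]. Qed.

(** Let g in GL(2,11) move the two independent vectors to (0,1) and (1,0), and let
    h = g diag(D,1), of determinant 1.  The Weil matrix of h moves the point
    vectors for z to those of the images under h, which are the point vectors of
    the images under g for the conjugate z^k with k = 1/D.  Up to signs and order, the
    images under g are in normal form. *)
Lemma det_neq0_of_plane i j : (i < 5)%N -> (j < 5)%N ->
  nth 0 s j 0 0 * nth 0 s i 0 1 - nth 0 s j 0 1 * nth 0 s i 0 0 != 0 ->
  \det (points_mx z s) != 0.
Proof.
move=> i5 j5; set v := nth 0 s i; set w := nth 0 s j; set D := (_ - _) => D0.
pose g := mx2 (v 0 1 / D) (- w 0 1 / D) (- v 0 0 / D) (w 0 0 / D).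
pose h := g *m mx2 D 0 0 1.
have dh : \det h = 1 by rewrite det_mulmx !det_mx2 /D; field; exact: D0.
have vg : v *m g = row2 0 1.
  rewrite -[v]row2E mul_row2 !mxE /=; congr row2; first by field.
  by rewrite /D; field; exact: D0.
have wg : w *m g = row2 1 0.
  rewrite -[w]row2E mul_row2 !mxE /=; congr row2; last by field.
  by rewrite /D; field; exact: D0.
pose k : nat := D^-1.
have kD : k%:R = D^-1 by rewrite natr_Zp.
have k0 : k%:R != 0 :> F11 by rewrite kD invr_eq0.
have gu : g \in unitmx.
  by move: dh; rewrite det_mulmx unitmxE unitfE => e; apply/eqP=> g0;
     move/eqP: e; rewrite g0 mul0r eq_sym oner_eq0.
have gal x : point_vec z (x *m h) = point_vec (z ^+ k) (x *m g).
  by rewrite (point_vec_galois _ z11 k0) kD invrK mulmxA.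
have zk1 := root_expr_neq1 z11 z1 k0.
have zk11 := root_expr z11 k.
have nz m : (m < 5)%N -> nth 0 s m *m g != 0.
  move=> m5; apply/eqP=> e; case/eqP: (nth_neq0 m5).
  by rewrite -[LHS](mulmxK gu) e mul0mx.
have hT m : (m < 5)%N -> exists2 u, u \in half_plane &
    nth 0 s m *m g = pair_row u \/ nth 0 s m *m g = - pair_row u.
  by move=> m5; apply: half_plane_repr (nz m m5).
pose P m u := (u \in half_plane) && ((nth 0 s m *m g == pair_row u) || (nth 0 s m *m g == - pair_row u)).
(* f m is the representative in the half plane of the image of the m-th
   vector. *)
have [f Pf] : exists f, forall m, (m < 5)%N -> P m (f m).
  exists (fun m => nth (0, 0)%N half_plane (find (P m) half_plane)) => m /hT[u hu e].
  apply: nth_find; apply/hasP; exists u; first by [].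
  by rewrite /P hu; case: e => ->; rewrite eqxx ?orbT.
have f_half m : (m < 5)%N -> f m \in half_plane by move/Pf/andP=> [].
have f_eq m u : (m < 5)%N -> P m u -> f m = u.
  move=> m5 /andP[hu e]; have /andP[hf e'] := Pf m m5; apply: pair_row_inj => //.
  exact: pm_eq e' e.
have f_inj : {in [pred m | (m < 5)%N] &, injective f}.
  move=> m n m5 n5 e; apply: (nth_pm_inj m5 n5).
  have := Pf m m5; have := Pf n n5; rewrite /P -e => /andP[_ en] /andP[_ em].
  have [/(can_inj (mulmxK gu))|] := pm_trans em en; first by left.
  by rewrite -mulNmx => /(can_inj (mulmxK gu)); right.
pose U := [seq f m | m <- iota 0 5].
have Uu : uniq U.
  rewrite map_inj_in_uniq ?iota_uniq // => m n; rewrite !mem_iota; exact: f_inj.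
have U01 : (0, 1)%N \in U.
  apply/mapP; exists i; rewrite ?mem_iota //; symmetry; apply: f_eq => //.
  apply/andP; split; first by vm_compute.
  by rewrite -/v vg; apply/orP; left; apply/rV2P; rewrite !mxE.
have U10 : (1, 0)%N \in U.
  apply/mapP; exists j; rewrite ?mem_iota //; symmetry; apply: f_eq => //.
  apply/andP; split; first by vm_compute.
  by rewrite -/w wg; apply/orP; left; apply/rV2P; rewrite !mxE.
have UP u : u \in U -> exists2 m, (m < 5)%N & u = f m.
  by move/mapP=> [m]; rewrite mem_iota => m5 ->; exists m.
have U5 : size U = 5%N by [].
have Uh u : u \in U -> u \in half_plane by case/UP=> m m5 ->; exact: f_half.
(* Forgetting the value of U keeps later simplification from unfolding it. *)
clearbody U.
pose R := [seq u <- half_rest | u \in U].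
have UR : perm_eq U [:: (0, 1)%N, (1, 0)%N & R].
  apply: uniq_perm => //.
    have Ru : uniq R by apply: filter_uniq; vm_compute.
    by rewrite /= Ru !inE !mem_filter /= !andbF.
  move=> u; rewrite !inE /R /half_rest !mem_filter.
  case: (u =P (0, 1)%N) => [->|_]; first by rewrite U01.
  case: (u =P (1, 0)%N) => [->|_]; first by rewrite U10.
  by case Uin: (u \in U) => //=; rewrite (Uh u Uin).
have R3 : size R = 3%N by have := perm_size UR; rewrite U5 => -[].
have Rs : subseq R half_rest by exact: filter_subseq.
case: R R3 Rs UR => [|a [|b [|c []]]] // _ Rs UR.
apply: (det_points_mx_weil dh); apply: det_neq0_span (normal zk11 zk1 Rs) => r.
rewrite rowK.
have : exists2 u, u \in U & nth 0 (normal_five a b c) r = pair_row u.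
  have mU u : u \in [:: (0, 1); (1, 0); a; b; c]%N -> u \in U by rewrite (perm_mem UR).
  case: r => [[|[|[|[|[|//]]]]] r]; [exists (0, 1)%N|exists c|exists (1, 0)%N|exists a|exists b] => //;
  by apply: mU; rewrite !inE eqxx ?orbT.
move=> [u /UP[m m5 ->] ->].
have [d d0 E] := row_points_mx_weil (Ordinal m5) dh.
have /andP[_ e] := Pf m m5; exists (Ordinal m5).
case/orP: e => /eqP e.
  by exists d^-1; rewrite E scalerA mulVf // scale1r gal /= e.
exists (- d^-1); rewrite E scalerA mulNr mulVf // scaleN1r gal /= e.
by rewrite point_vecN opprK.
Qed.

(** Either one of the vectors is independent of the first, or all five lie on
    the line of the first.  In the second case they can be moved to (0, x) for the five
    values of x up to sign, and their point vectors become, up to sign, the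
    five unit vectors. *)
Lemma five_points_independent : \det (points_mx z s) != 0.
Proof.
pose D i j := nth 0 s j 0 0 * nth 0 s i 0 1 - nth 0 s j 0 1 * nth 0 s i 0 0.
case: (altP (@forallP 'I_5 (fun j => D 0%N j == 0))) => [dep|]; last first.
  by rewrite negb_forall => /existsP[j D0]; apply: (@det_neq0_of_plane 0 j).
have [h dh hs] := complete_row1 (nth_neq0 (ltn0Sn 4)).
have hu : h \in unitmx by rewrite unitmxE dh unitr1.
pose g := invmx h; have dg : \det g = 1 by rewrite det_inv dh invr1.
have s0g : nth 0 s 0 *m g = row2 0 1.
  rewrite -hs -row_mul mulmxV //; apply/eqP/rV2P; rewrite !mxE; by split.
have sg (i : 'I_5) : exists x, nth 0 s i *m g = row2 0 x.
  have /eqP := dep i; rewrite /D => e.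
  exists ((nth 0 s i *m g) 0 1); rewrite -[LHS]row2E; congr row2.
  have mulg (v : 'rV[F11]_2) : (v *m g) 0 0 = v 0 0 * g 0 0 + v 0 1 * g 1 0 /\
      (v *m g) 0 1 = v 0 0 * g 0 1 + v 0 1 * g 1 1.
    by have := mul_row2 (v 0 0) (v 0 1) g; rewrite row2E => ->; rewrite !mxE.
  have [a0 a1] := mulg (nth 0 s 0); have [b0 _] := mulg (nth 0 s i).
  rewrite s0g !mxE /= in a0 a1.
  have : \det (mx2 (nth 0 s 0 0 0) (nth 0 s 0 0 1) (nth 0 s i 0 0) (nth 0 s i 0 1) *m
    mx2 (g 0 0) (g 0 1) (g 1 0) (g 1 1)) = 0.
    by rewrite det_mulmx -mx2E dg mulr1 det_mx2 -[RHS]oppr0 -e; ring.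
  by rewrite mulmx2 det_mx2 -a0 -a1 -b0 mul0r sub0r mul1r => /eqP; rewrite oppr_eq0 => /eqP.
apply: (det_points_mx_weil dg).
pose x (i : 'I_5) := (nth 0 s i *m g) 0 1.
have xE (i : 'I_5) : nth 0 s i *m g = row2 0 (x i).
  by have [t e] := sg i; rewrite /x e !mxE.
have x0 i : x i != 0.
  apply/eqP=> e; case/eqP: (nth_neq0 (ltn_ord i)); rewrite -[LHS](mulmxKV hu) -/g xE e.
  rewrite (_ : row2 0 0 = 0) ?mul0mx //.
  by apply/eqP/rV2P; rewrite !mxE.
have hp i : {j | ((x i)^-1 == half_point j) || ((x i)^-1 == - half_point j)}.
  have xi : (x i)^-1 != 0 by rewrite invr_eq0.
  by apply: sigW; have [j [] ->] := half_pointP xi; exists j; rewrite eqxx ?orbT.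
pose f i := sval (hp i).
have fE i : (x i)^-1 = half_point (f i) \/ (x i)^-1 = - half_point (f i).
  by case/orP: (svalP (hp i)) => /eqP; [left|right].
have f_inj : injective f.
  move=> i j ij; apply: val_inj; apply: nth_pm_inj => //=.
  have := fE i; rewrite ij => ei; have ej := fE j.
  have : x i = x j \/ x i = - x j.
    case: ei ej => ei [] ej; [left|right|right|left];
      by apply: invr_inj; rewrite ?invrN ei ej ?opprK.
  case=> e; [left|right]; apply: (can_inj (mulmxK (_ : g \in unitmx)));
    rewrite ?unitmxE ?dg ?unitr1 // ?mulNmx !xE e //.
  by apply/eqP/rV2P; rewrite !mxE oppr0.
have [f' fK f'K] : bijective f by apply: injF_bij.
apply: (@det_neq0_span _ _ 1%:M); last by rewrite det1 oner_neq0.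
move=> y; have [c c0 E] := row_points_mx_weil (f' y) dg.
have P : point_vec z (row2 0 (x (f' y))) = row y 1%:M \/ point_vec z (row2 0 (x (f' y))) = - row y 1%:M.
  case: (fE (f' y)); rewrite f'K => e; [left|right]; apply/rowP=> j;
    rewrite !mxE /point_fun /= e ?opprK !half_point_eq !half_point_eqN (eq_sym j) ?subr0 ?sub0r //.
exists (f' y); case: P => P; [exists c^-1|exists (- c^-1)]; rewrite E xE P scalerA ?mulNr mulVf //.
  by rewrite scale1r.
by rewrite scaleN1r opprK.
Qed.

End Reduction.

(** * Projective action of a representation of PSL(2,11) *)

Section Subspaces.

Variable F : finFieldType.
Local Notation subspace := {vspace 'rV[F]_5}.

(** The action of GL on subspaces, extended to all matrices. *)
Definition linact (M : 'M[F]_5) (U : subspace) : subspace := (linfun (mulmxr M) @: U)%VS.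

Lemma linact_line M (v : 'rV[F]_5) : linact M <[v]>%VS = <[v *m M]>%VS.
Proof. by rewrite /linact limg_line lfunE. Qed.

Lemma dim_rowspace (M : 'M[F]_5) (U : subspace) :
  \det M != 0 -> (forall i, row i M \in U) -> \dim U = 5%N.
Proof.
move=> dM hU; have uM : M \in unitmx by rewrite unitmxE unitfE.
suff -> : U = fullv by rewrite dimvf /dim /= mul1n.
apply/vspaceP => v; rewrite memvf -[v](mulmxKV uM) mulmx_sum_row.
by apply: memv_suml => i _; apply: memvZ.
Qed.

(** The kernel of a nonzero linear form that vanishes on the rows. *)
Lemma hyperplane_rowspace (M : 'M[F]_5) : \det M = 0 ->
  exists2 H : subspace, \dim H = 4%N & forall i, row i M \in H.
Proof.
move=> /eqP; rewrite -det_tr => /det0P[w w0 wM].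
pose f : 'Hom('rV[F]_5, 'rV[F]_1) := linfun (mulmxr w^T).
have wM' : M *m w^T = 0 by apply: trmx_inj; rewrite trmx_mul trmxK trmx0.
exists (lker f) => [|i]; last by rewrite memv_ker lfunE /= -row_mul wM' row0.
have := limg_ker_dim f fullv; rewrite capfv [\dim {:'rV[F]_5}]dimvf.
suff -> : limg f = fullv by rewrite dimvf addn1 => -[].
have [j wj] : exists j, w 0 j != 0 by apply/rV0Pn.
apply/vspaceP=> v; rewrite memvf; apply/memv_imgP.
exists ((v 0 0 / w 0 j) *: delta_mx 0 j); first exact: memvf.
rewrite lfunE /= -scalemxAl -rowE; apply/rowP=> k; rewrite !mxE ord1.
by rewrite mulfVK.
Qed.

End Subspaces.

Section Representation.

Variable F : finFieldType.
Variable rH : mx_representation F (PSLgroup 2 F11) 5.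

(** Matrices of determinant 1 are used instead of elements of the finite group, so
    that explicit 2 by 2 computations apply; [slrep] is then a function of plain
    matrices, meaningful for determinant 1 only. *)
Definition to_SL (g : 'M[F11]_2) : {'GL_2[F11]} := insubd (1%g : {'GL_2[F11]}) g.

Lemma to_SL_val g : \det g = 1 -> GLval (to_SL g) = g.
Proof.
move=> dg; have := @val_insubd _ _ {'GL_2[F11]} (1%g : {'GL_2[F11]}) g.
by rewrite /= unitmxE dg unitr1.
Qed.

Lemma to_SL_in g : \det g = 1 -> to_SL g \in SLgroup 2 F11.
Proof. by move=> dg; rewrite inE [val _]to_SL_val // dg. Qed.

Lemma to_SLK (x : {'GL_2[F11]}) : to_SL (GLval x) = x.
Proof. exact: valKd. Qed.

Lemma to_SLM g h : \det g = 1 -> \det h = 1 -> to_SL (g *m h) = (to_SL g * to_SL h)%g.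
Proof.
move=> dg dh; apply: val_inj; rewrite [RHS]GL_ME.
by rewrite [LHS]to_SL_val ?det_mulmx ?dg ?dh ?mulr1 // !to_SL_val.
Qed.

Lemma SL_normZ : (SLgroup 2 F11 \subset 'N('Z(SLgroup 2 F11)))%g.
Proof. exact: normal_norm (center_normal _). Qed.

Definition slrep (g : 'M[F11]_2) : 'M[F]_5 := rH (coset 'Z(SLgroup 2 F11)%g (to_SL g)).

Lemma coset_in x : x \in SLgroup 2 F11 -> coset 'Z(SLgroup 2 F11)%g x \in PSLgroup 2 F11.
Proof. by move=> hx; apply: mem_quotient. Qed.

Lemma coset_SLM x y : x \in SLgroup 2 F11 -> y \in SLgroup 2 F11 ->
  coset 'Z(SLgroup 2 F11)%g (x * y)%g =
  (coset 'Z(SLgroup 2 F11)%g x * coset 'Z(SLgroup 2 F11)%g y)%g.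
Proof. by move=> hx hy; apply: coset_morphM; apply: (subsetP SL_normZ). Qed.

Lemma slrepM g h : \det g = 1 -> \det h = 1 -> slrep (g *m h) = slrep g *m slrep h.
Proof.
move=> dg dh; have [gS hS] := (to_SL_in dg, to_SL_in dh).
rewrite /slrep (to_SLM dg dh) (coset_SLM gS hS).
exact: repr_mxM (coset_in gS) (coset_in hS).
Qed.

Lemma slrep1 : slrep 1%:M = 1%:M.
Proof.
have e : to_SL 1%:M = 1%g by apply: val_inj; rewrite [LHS]to_SL_val ?det1 // GL_1E.
rewrite /slrep e coset_id ?group1 //; exact: repr_mx1.
Qed.

Lemma det_oppr2 : \det (- 1%:M : 'M[F11]_2) = 1.
Proof. by rewrite -scaleN1r detZ det1 mulr1 sqrrN expr1n. Qed.

Lemma slrepN1 : slrep (- 1%:M) = 1%:M.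
Proof.
rewrite /slrep coset_id ?repr_mx1 //; apply/centerP; split.
  by apply: to_SL_in; exact: det_oppr2.
move=> x _; apply: val_inj; rewrite [LHS]GL_ME [RHS]GL_ME to_SL_val ?det_oppr2 //.
by rewrite [LHS]mulNmx [RHS]mulmxN mul1mx mulmx1.
Qed.

Lemma proj_image_act x : x \in proj_image rH ->
  exists2 g, \det g = 1 & forall U, PGL_action F U x = linact (slrep g) U.
Proof.
move=> /morphimP[y _ /morphimP[t _ /morphimP[g _ gSL ->] ->] ->].
have dg : \det (GLval g) = 1 by move: gSL; rewrite inE => /eqP.
exists (GLval g) => // U; rewrite PGL_actionE /subspace_act /linact.
rewrite [GLval (reprGLm _ _)]val_reprGLm ?coset_in //.
by rewrite /slrep to_SLK.
Qed.

Definition proj_lift (g : 'M[F11]_2) : PGLtype 5 F :=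
  coset _ (reprGLm rH (coset 'Z(SLgroup 2 F11)%g (to_SL g))).

Lemma proj_lift_in g : \det g = 1 -> proj_lift g \in proj_image rH.
Proof.
move=> dg; have gP := coset_in (to_SL_in dg).
by apply: mem_quotient; exact: (mem_morphim _ gP gP).
Qed.

Lemma proj_lift_act g U : \det g = 1 -> PGL_action F U (proj_lift g) = linact (slrep g) U.
Proof.
move=> dg; rewrite PGL_actionE /subspace_act /linact.
by rewrite [GLval (reprGLm _ _)]val_reprGLm ?coset_in ?to_SL_in.
Qed.

Lemma proj_liftM g h : \det g = 1 -> \det h = 1 ->
  proj_lift (g *m h) = (proj_lift g * proj_lift h)%g.
Proof.
move=> dg dh; have [gS hS] := (to_SL_in dg, to_SL_in dh).
rewrite /proj_lift (to_SLM dg dh) (coset_SLM gS hS).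
rewrite (reprGLmM rH (coset_in gS) (coset_in hS)).
by apply: coset_morphM; apply: (subsetP (normal_norm (center_normal 'GL_5[F]%G))); rewrite inE.
Qed.

Lemma proj_lift1 : proj_lift 1%:M = 1%g.
Proof.
have e := proj_liftM (det1 _ 2) (det1 _ 2); rewrite mul1mx in e.
by apply: (mulgI (proj_lift 1%:M)); rewrite -[LHS]e [RHS]mulg1.
Qed.

Lemma proj_lift_unipotentX n : proj_lift (unipotent n%:R) = (proj_lift (unipotent 1%R) ^+ n)%g.
Proof.
elim: n => [|n IH]; first by rewrite [unipotent _]mx2_1 proj_lift1.
have -> : unipotent n.+1%:R = unipotent n%:R *m unipotent 1 by rewrite mulmx2 -natr1; congr mx2; ring.
rewrite (proj_liftM (det_unipotent _) (det_unipotent _)) IH.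
by rewrite -expgSr.
Qed.

End Representation.

(** * The Weil representation of PSL(2,11) is irreducible and faithful *)

Lemma opp_mx2_1 : - 1%:M = mx2 (- 1) 0 0 (- 1) :> 'M[F11]_2.
Proof. by rewrite -mx2_1; apply/matrixP=> i j; rewrite !mxE; case: eqP; case: eqP; rewrite ?oppr0. Qed.

(** Commuting with one unipotent matrix and with the Weyl element is enough. *)
Lemma SL_center (x : {'GL_2[F11]}) : x \in 'Z(SLgroup 2 F11)%g ->
  GLval x = 1%:M \/ GLval x = - 1%:M.
Proof.
case/centerP; rewrite inE => /eqP dx xc.
have comm g : \det g = 1 -> GLval x *m g = g *m GLval x.
  move=> dg; have := congr1 GLval (xc _ (to_SL_in dg)).
  by rewrite !GL_ME /= to_SL_val.
have := comm _ (det_unipotent 1); have := comm _ det_weyl; move: dx; rewrite -[val x]/(GLval x).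
rewrite [GLval x]mx2E; move: (_ 0 0) (_ 0 1) (_ 1 0) (_ 1 1) => a b c d.
rewrite det_mx2 !mulmx2 !(mulr0, mulr1, mul0r, mul1r, add0r, addr0, mulN1r, mulrN1).
move=> dg /matrixP ew /matrixP eu.
have := ew 0 0; have := ew 0 1; have := eu 0 0; rewrite !mxE /= => e1 e2 e3.
have c0 : c = 0 by apply: (addrI a); rewrite addr0 -e1.
have b0 : b = 0 by apply: oppr_inj; rewrite e3 c0 oppr0.
have a2 : a ^+ 2 = 1 by rewrite -dg c0 b0 mul0r subr0 -e2 expr2.
rewrite c0 b0 -e2; have /eqP := a2; rewrite sqrf_eq1 => /orP[] /eqP ->.
  by left; rewrite mx2_1.
by right; rewrite opp_mx2_1.
Qed.

Section Weil.

Variables (F : finFieldType) (z : F).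
Hypotheses (z11 : z ^+ 11 = 1) (z1 : z != 1).

Lemma weilN1 : weil z (- 1%:M) = 1%:M.
Proof.
apply/matrixP=> i j; rewrite opp_mx2_1 !mxE weil_kernel_mx2 eqxx mulr0 mul0r (psi0 z) mulr1.
rewrite chiN ?oner_neq0 // chi1 !mulN1r opprK opprB half_point_eq half_point_eqN.
by rewrite subr0 eq_sym.
Qed.

Lemma weil_kernel_neq0 (g : 'M[F11]_2) (x y : F11) :
  g 1 0 != 0 -> x != 0 -> y != 0 -> weil_kernel z g x y != 0.
Proof.
rewrite /weil_kernel => c0 x0 y0; rewrite (negPf c0) !mulf_neq0 ?invr_eq0 ?(gsum_neq0 z11 z1) ?chi_neq0 //.
  exact: psi_neq0 z11 _.
rewrite subr_eq0; apply/eqP=> /(psi_inj z11 z1); set t := (_ / _) => e.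
have : 4%:R * x * y / g 1 0 == 0.
  have -> : 4%:R * x * y / g 1 0 = t - - t by rewrite /t; ring.
  by rewrite e subrr.
by rewrite !mulf_eq0 invr_eq0 (negPf c0) (negPf x0) (negPf y0).
Qed.

(** A scalar matrix has zero entries off the diagonal, which excludes c != 0.  For
    c = 0 equality of the diagonal entries at the half points 1 and 2
    forces a = 1 or a = -1, and b = 0. *)
Lemma weil_scalar g s : \det g = 1 -> weil z g = s%:M -> g = 1%:M \/ g = - 1%:M.
Proof.
move=> dg eM; have s0 : s != 0.
  have := weil_unit z11 z1 dg; rewrite eM unitmxE det_scalar unitrX_pos // unitfE //.
have /matrixP e := eM.
pose i1 : 'I_5 := inord 1.
have h1 : half_point i1 = 2%:R by rewrite /half_point inordK.
have g10 : g 1 0 = 0.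
  apply/eqP/contraT=> c0; have := weil_kernel_neq0 c0 (half_point_neq0 0) (half_point_neq0 i1).
  by have := e 0 i1; rewrite !mxE -val_eqE /= inordK // => ->; rewrite eqxx.
have := e 0 0; have := e i1 i1; rewrite !mxE half_point0 h1 !eqxx.
move: dg g10; rewrite [g]mx2E; move: (_ 0 0) (_ 0 1) (_ 1 0) (_ 1 1) => a b c d.
rewrite det_mx2 !weil_kernel_mx2 mxE /= => dg c0; rewrite c0 eqxx.
have ad : a * d = 1 by rewrite -dg c0 mulr0 subr0.
have a0 : a != 0 by apply/eqP=> a0; move/eqP: ad; rewrite a0 mul0r eq_sym oner_eq0.
rewrite !mulr1 expr1n mulr1 !mulr1n => e11 e00.
have two : (2%:R == - 2%:R :> F11) = false by [].
have one : (1 == - 1 :> F11) = false by [].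
have [a1|a1] : a = 1 \/ a = - 1.
- case: (1 =P a) e00 => [<-|_]; first by left.
  case: (1 =P - a) => [->|_]; first by rewrite opprK; right.
  by rewrite subrr mulr0 => s00; rewrite -s00 eqxx in s0.
- have d1 : d = 1 by rewrite -[d]mul1r -a1 ad.
  move: e11 e00; rewrite a1 !mul1r !eqxx two one ?chi1 ?mul1r subr0 !mulr1 => f1 f2.
  have e0 := psi_inj z11 z1 (etrans f1 (esym f2)).
  left; rewrite d1 -mx2_1; congr mx2; apply/eqP.
  have : b * (2%:R ^+ 2 - 1) == 0 by rewrite mulrBr mulr1 subr_eq0 e0.
  by rewrite mulf_eq0 orbF.
have d1 : d = - 1 by rewrite -ad a1 mulN1r opprK.
move: e11 e00; rewrite a1 !mulN1r opprK !eqxx two one !sub0r ?mulrNN ?mulr1 => f1 f2.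
have e0 := psi_inj z11 z1 (etrans f1 (esym f2)).
right; rewrite d1 opp_mx2_1; congr mx2; apply/eqP.
have : - b * (2%:R ^+ 2 - 1) == 0 by rewrite mulrBr mulr1 subr_eq0 e0.
by rewrite mulf_eq0 oppr_eq0 orbF.
Qed.

Definition weil_fun (x : {'GL_2[F11]}) : 'M[F]_5 := weil z (GLval x).

Lemma weil_repr : mx_repr (SLgroup 2 F11) weil_fun.
Proof.
split=> [|x y]; first by rewrite /weil_fun GL_1E weil1.
by rewrite !inE => /eqP dx /eqP dy; rewrite /weil_fun GL_ME (weilM z11 z1).
Qed.

Definition weil_rep := MxRepresentation weil_repr.

Lemma center_rker : ('Z(SLgroup 2 F11) \subset rker weil_rep)%g.
Proof.
apply/subsetP=> x xZ; apply/rkerP; split; first by case/centerP: xZ.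
by rewrite /= /weil_fun; case: (SL_center xZ) => ->; rewrite ?weil1 ?weilN1.
Qed.

Definition weil_psl : mx_representation F (PSLgroup 2 F11) 5 := quo_repr center_rker SL_normZ.

Lemma slrep_weil g : \det g = 1 -> slrep weil_psl g = weil z g.
Proof.
by move=> dg; rewrite /slrep quo_repr_coset ?to_SL_in //= /weil_fun to_SL_val.
Qed.

Lemma weil_unipotent j : weil z (unipotent j) = diag_mx (\row_i psi z (j * half_point i ^+ 2)).
Proof.
apply/matrixP=> i k; rewrite !mxE weil_kernel_mx2 eqxx !mul1r ?chi1 ?mul1r.
by rewrite half_point_eq half_point_eqN subr0 eq_sym mulr_natr.
Qed.

(** The projection onto the unit vectors at the half points whose square is t;
    it is zero if t is not a nonzero square. *)
Definition coord_proj (t : F11) : 'M[F]_5 := diag_mx (\row_i (half_point i ^+ 2 == t)%:R).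

(** Fourier inversion on the unipotent subgroup, whose Weil matrices are diagonal
    with entries psi (j x^2). *)
Lemma sum_weil_unipotent t :
  \sum_j psi z (- (t * j)) *: weil z (unipotent j) = 11%:R *: coord_proj t.
Proof.
apply/matrixP=> i k; rewrite summxE !mxE.
under eq_bigr do rewrite weil_unipotent !mxE.
case: eqP => _; last by rewrite mulr0n mulr0 big1 // => j _; rewrite mulr0n mulr0.
rewrite mulr1n (eq_bigr (fun j => psi z ((half_point i ^+ 2 - t) * j))) => [|j _]; last first.
  by rewrite mulr1n -(psiD z11); congr psi; ring.
rewrite (sum_psi z11 z1) subr_eq0; case: eqP; by rewrite ?mulr1 ?mulr0.
Qed.

(** A submodule is stable under the projections onto the coordinate axes, which are
    combinations of unipotent matrices.  If it is nonzero it contains a unit vector,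
    and then all of them since the Weyl matrix has no zero entry. *)
Lemma weil_irr : mx_irreducible weil_psl.
Proof.
apply/quo_mx_irr/mx_irrP; split=> // U modU U0.
have stab g : \det g = 1 -> (U *m weil z g <= U)%MS.
  move=> dg; have := mxmoduleP modU _ (to_SL_in dg).
  by rewrite /= /weil_fun to_SL_val.
have /existsP[i /existsP[j Uij]] : [exists i, exists j, U i j != 0].
  apply: contraR U0; rewrite negb_exists => /forallP h; apply/eqP/matrixP=> i j; rewrite mxE.
  by have := h i; rewrite negb_exists => /forallP/(_ j)/negPn/eqP.
have proj m (V : 'M_(m, 5)) t : (V <= U)%MS -> (V *m coord_proj t <= U)%MS.
  move=> VU; rewrite -(eqmx_scale _ (eleven_neq0 z11 z1)) scalemxAr -sum_weil_unipotent mulmx_sumr.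
  apply: summx_sub => k _; rewrite -scalemxAr; apply: scalemx_sub.
  exact: submx_trans (submxMr _ VU) (stab _ (det_unipotent k)).
have projd (v : 'rV_5) k : v *m coord_proj (half_point k ^+ 2) = v 0 k *: delta_mx 0 k.
  apply/rowP=> l; rewrite mul_mx_diag !mxE eqf_sqr half_point_eq half_point_eqN orbF eqxx /=.
  by case: eqP => [->|_]; rewrite ?mulr1 ?mulr0.
have deltaU (v : 'rV_5) k : (v <= U)%MS -> v 0 k != 0 -> ((delta_mx 0 k : 'rV_5) <= U)%MS.
  by move=> /(proj _ _ (half_point k ^+ 2)); rewrite projd => h v0; rewrite -(eqmx_scale _ v0).
have jU : ((delta_mx 0 j : 'rV_5) <= U)%MS by apply: (deltaU (row i U)); rewrite ?row_sub ?mxE.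
rewrite -sub1mx; apply/row_subP=> k; rewrite row1.
apply: (deltaU (delta_mx 0 j *m weil z weyl)).
  exact: submx_trans (submxMr _ jU) (stab _ det_weyl).
rewrite -rowE !mxE; apply: weil_kernel_neq0; rewrite ?half_point_neq0 //.
by rewrite mxE.
Qed.

Lemma weil_psl_scalar x s : x \in PSLgroup 2 F11 -> weil_psl x = s%:M -> x = 1%g.
Proof.
case/morphimP=> g _ gSL ->; have dg : \det (GLval g) = 1 by move: gSL; rewrite inE => /eqP.
rewrite [LHS]quo_repr_coset //= /weil_fun => /(weil_scalar dg) g1.
apply: coset_id; apply/centerP; split=> // h _; apply: val_inj; rewrite [LHS]GL_ME [RHS]GL_ME.
case: g1 => ->; first by rewrite [LHS]mul1mx [RHS]mulmx1.
by rewrite [LHS]mulNmx [RHS]mulmxN mul1mx mulmx1.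
Qed.

(** No element other than 1 acts as a scalar, so that the representation stays
    faithful in PGL(5,F). *)
Lemma proj_weil_isog : (proj_image weil_psl \isog PSLgroup 2 F11)%g.
Proof.
have inj : ('injm (reprGLm weil_psl))%g.
  apply/subsetP=> x; rewrite ker_reprGLm => /rkerP[xH x1].
  by rewrite inE; apply/eqP/(weil_psl_scalar xH x1).
rewrite isog_sym; apply: isog_trans (sub_isog (subxx _) inj) _.
apply: quotient_isog.
  exact: subset_trans (subsetT _) (normal_norm (center_normal _)).
apply/trivgP/subsetP=> y /setIP[/GL5_center_scalar[a _ ya] /morphimP[x _ xH yx]].
rewrite inE yx (_ : x = 1%g) ?morph1 //; apply: (weil_psl_scalar (s := a) xH).
by rewrite -(val_reprGLm weil_psl xH) -yx.
Qed.

End Weil.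

(** * Sixty points forming an arc *)

Lemma vline_scale (K : fieldType) (vT : vectType K) c (v : vT) :
  c != 0 -> <[c *: v]>%VS = <[v]>%VS.
Proof.
move=> c0; apply/eqP; rewrite eqEsubv -!memvE memvZ ?memv_line //=.
by rewrite -{1}[v](scalerK c0) memvZ ?memv_line.
Qed.

Lemma pair_row_neq0 u : u \in half_plane -> pair_row u != 0.
Proof.
move=> hu; apply/negP => /rV2P; rewrite !mxE /= => -[/eqP e1 /eqP e2].
have H : all (fun u => ~~ ((u.1%:R == 0 :> F11) && (u.2%:R == 0 :> F11))) half_plane by vm_compute.
by have := allP H u hu; rewrite e1 e2.
Qed.

Lemma half_plane_pmdiff us : uniq us -> {subset us <= half_plane} ->
  pairwise pmdiff [seq pair_row u | u <- us].
Proof.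
elim: us => [//|u us IH] /= /andP[uus Uus] hs; rewrite IH ?andbT //; last first.
  by move=> v vus; apply: hs; rewrite inE vus orbT.
apply/allP=> _ /mapP[v vus ->]; apply/andP; split; apply: contraNneq uus => e;
  rewrite (@pair_row_inj u v) ?hs ?inE ?eqxx ?vus ?orbT //; [by left|by right].
Qed.

Section Arc.

Variables (p : nat) (z : 'F_p).
Hypotheses (z11 : z ^+ 11 = 1) (z1 : z != 1).
Hypothesis normal : forall (z : 'F_p) a b c, z ^+ 11 = 1 -> z != 1 ->
  subseq [:: a; b; c] half_rest -> \det (points_mx z (normal_five a b c)) != 0.

Local Notation F := 'F_p.

Definition weil_point (u : nat * nat) : {vspace 'rV[F]_5} := <[point_vec z (pair_row u)]>%VS.

(** The orbit of the first unit vector, which is the point vector of (0, 1). *)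
Definition weil_orbit : {set {vspace 'rV[F]_5}} :=
  orbit (PGL_action F) (proj_image (weil_psl z11 z1)) (weil_point (0, 1)%N).

Lemma mem_weil_orbit : weil_orbit =i [seq weil_point u | u <- half_plane].
Proof.
have half01 : (0, 1)%N \in half_plane by vm_compute.
have v01 := pair_row_neq0 half01.
have r1 (g : 'M[F11]_2) : pair_row (0, 1)%N *m g = row 1 g.
  rewrite (_ : pair_row _ = delta_mx 0 1) -?rowE //; apply/eqP/rV2P; rewrite !mxE //.
move=> U; apply/orbitP/mapP => [[x xG <-]|[u hu ->]].
  have [g dg ->] := proj_image_act xG.
  rewrite linact_line slrep_weil //; have [s s0 ->] := point_vec_weil z11 z1 v01 dg.
  have gu : g \in unitmx by rewrite unitmxE dg unitr1.
  have vg : pair_row (0, 1)%N *m g != 0.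
    by apply: contraNneq v01 => e; rewrite -[pair_row _](mulmxK gu) e mul0mx.
  have [u hu e] := half_plane_repr vg; exists u; first by [].
  rewrite (vline_scale _ s0); case: e => ->; first by [].
  by rewrite point_vecN /weil_point -scaleN1r vline_scale // oppr_eq0 oner_eq0.
have [g dg gu] := complete_row1 (pair_row_neq0 hu).
exists (proj_lift (weil_psl z11 z1) g); first exact: proj_lift_in.
rewrite proj_lift_act // linact_line slrep_weil //; have [s s0 ->] := point_vec_weil z11 z1 v01 dg.
by rewrite (vline_scale _ s0) r1 gu.
Qed.

Lemma point_vec_neq0 (v : 'rV[F11]_2) : v != 0 -> point_vec z v != 0.
Proof.
move=> v0; have [g dg gv] := complete_row1 v0; have ug := weil_unit z11 z1 dg.
apply/eqP=> e; have := row0_weil z11 dg; rewrite gv e scaler0 => r0.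
have := congr1 (fun M => row 0 M) (mulmxV ug); rewrite row_mul r0 mul0mx => /rowP/(_ 0)/eqP.
by rewrite !mxE eqxx eq_sym oner_eq0.
Qed.

Lemma half_det us : uniq us -> size us = 5%N -> {subset us <= half_plane} ->
  \det (points_mx z [seq pair_row u | u <- us]) != 0.
Proof.
move=> Uus us5 hs; apply: (five_points_independent normal) => //; first by rewrite size_map.
  exact: half_plane_pmdiff.
by apply/negP=> /mapP[u /hs/pair_row_neq0/eqP h /esym].
Qed.

Lemma row_points_mx us i : size us = 5%N -> row i (points_mx z [seq pair_row u | u <- us]) =
  point_vec z (pair_row (nth (0, 0)%N us i)).
Proof. by move=> us5; rewrite rowK (nth_map (0, 0)%N) // us5 ltn_ord. Qed.

(** If two of the points coincided, then with three further points they would make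
    five independent vectors inside the span of four. *)
Lemma weil_point_inj : {in half_plane &, injective weil_point}.
Proof.
move=> u u' hu hu' e; apply/eqP; apply/negPn/negP=> uu'.
pose us := [:: u, u' & take 3 [seq v <- take 5 half_plane | v \notin [:: u; u']]].
have us5 : size us = 5%N.
  have: all (fun u => all (fun u' => size (take 3 [seq v <- take 5 half_plane | v \notin [:: u; u']])
     == 3%N) half_plane) half_plane by vm_compute.
  by move/allP/(_ u hu)/allP/(_ u' hu')/eqP => h; rewrite /= h.
have hs : {subset us <= half_plane}.
  move=> v; case/predU1P => [->//|]; case/predU1P => [->//|/mem_take].
  by rewrite mem_filter => /andP[_ /mem_take].
have Uus : uniq us.
  have : uniq (take 3 [seq v <- take 5 half_plane | v \notin [:: u; u']]).
    by apply/take_uniq/filter_uniq; vm_compute.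
  have n (v : nat * nat) : v \in [:: u; u'] ->
      v \notin take 3 [seq v <- take 5 half_plane | v \notin [:: u; u']].
    by move=> h; apply/negP=> /mem_take; rewrite mem_filter h.
  have nu := n _ (mem_head u [:: u']); have nu' : u' \in [:: u; u'] by rewrite !inE eqxx orbT.
  move: nu (n _ nu'); rewrite /us; move: (take 3 _) => t ut u't tt.
  by rewrite /= inE negb_or uu' ut u't tt.
pose V := <<[seq point_vec z (pair_row v) | v <- u :: drop 2 us]>>%VS.
have : \dim V = 5%N.
  apply: dim_rowspace (half_det Uus us5 hs) _ => i; rewrite row_points_mx //.
  have su v : v \in u :: drop 2 us -> point_vec z (pair_row v) \in V.
    by move=> h; apply/memv_span/(map_f (fun v => point_vec z (pair_row v))).
  case: i => [[|[|i]] i5]; first by apply: su; rewrite inE eqxx.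
    suff : (<[point_vec z (pair_row u')]> <= V)%VS by rewrite -memvE.
    by rewrite -[<[_]>%VS]e -memvE; apply: su; rewrite inE eqxx.
  apply: su; rewrite [nth _ _ _](_ : _ = nth (0, 0)%N (drop 2 us) i); last by rewrite nth_drop.
  by rewrite in_cons mem_nth ?orbT // size_drop us5.
move=> dV; have := dim_span [seq point_vec z (pair_row v) | v <- u :: drop 2 us].
by rewrite -/V dV size_map -[size (_ :: _)]/(size (drop 2 us)).+1 size_drop us5.
Qed.

Lemma weil_point_uniq : uniq [seq weil_point u | u <- half_plane].
Proof. by rewrite map_inj_in_uniq; [vm_compute|exact: weil_point_inj]. Qed.

Lemma card_set_seq (T : finType) (A : {set T}) (s : seq T) : A =i s -> uniq s -> #|A| = size s.
Proof. by move=> /eq_card As /card_uniqP <-. Qed.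

Lemma card_weil_orbit : #|weil_orbit| = 60%N.
Proof. by rewrite (card_set_seq mem_weil_orbit weil_point_uniq) size_map. Qed.

(** Five vectors inside a hyperplane are dependent, against
    [five_points_independent]. *)
Lemma weil_orbit_arc : is_arc 60 weil_orbit.
Proof.
split.
- move=> P; rewrite mem_weil_orbit => /mapP[u hu ->].
  by rewrite /PG4_point dim_vline (point_vec_neq0 (pair_row_neq0 hu)).
- exact: card_weil_orbit.
move=> S SA S5 [H /eqP H4 SH].
pose us := [seq u <- half_plane | weil_point u \in S].
have hs : {subset us <= half_plane} by move=> u; rewrite mem_filter => /andP[].
have Uus : uniq us by apply: filter_uniq; vm_compute.
have us5 : size us = 5%N.
  have UU : uniq [seq weil_point u | u <- us].
    by rewrite map_inj_in_uniq // => u v /hs hu /hs hv; apply: weil_point_inj.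
  rewrite -(size_map weil_point) -[RHS]S5; symmetry; apply: card_set_seq UU => P.
  apply/idP/mapP => [PS|[u]]; last by rewrite mem_filter => /andP[h _] ->.
  have := subsetP SA P PS; rewrite mem_weil_orbit => /mapP[u hu Pu].
  by exists u; rewrite // mem_filter -Pu PS.
suff : \dim H = 5%N by rewrite H4.
apply: dim_rowspace (half_det Uus us5 hs) _ => i; rewrite row_points_mx // memvE; apply: SH.
have : nth (0, 0)%N us i \in us by rewrite mem_nth // us5 ltn_ord.
by rewrite mem_filter => /andP[].
Qed.

Lemma weil_orbit_transitive : PSL211_transitive weil_orbit.
Proof.
exists (proj_image (weil_psl z11 z1)); split.
- exact: proj_weil_isog.
- by exists (weil_psl z11 z1); first exact: weil_irr.
- apply: acts_orbit; apply/subsetP => x _; have [y _ ->] := cosetP x.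
  by apply: mem_quotient; rewrite inE.
exact: atrans_orbit.
Qed.

End Arc.

(** * A representation is determined by its torus and unipotent matrices *)

(** The coefficient of the k-th unknown in the equation [bessel_relation] for the
    half point y and the character of index -t: both j = y/k and j = -y/k
    contribute to it. *)
Definition bessel_entry (y t k : nat) : sparse :=
  let s := (y * F11inv k %% 11)%N \notin [:: 1; 3; 4; 5; 9]%N in
  [:: (s, (t * y * F11inv k + 10 * ((1 + y * y) * k * F11inv y)) %% 11)%N;
      (s, (10 * (t * y * F11inv k) + (1 + y * y) * k * F11inv y) %% 11)%N].

Definition bessel_row (c : nat * nat) : seq sparse := [seq bessel_entry c.1 c.2 k | k <- iota 1 5].

(** For these five pairs (y, t), -t is zero or not a square, as
    [bessel_relation] requires, and the equations are independent over every field
    with a primitive 11th root of unity. *)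
Definition bessel_rows : seq (nat * nat) := [:: (1, 0); (1, 1); (1, 3); (1, 4); (5, 4)]%N.

Definition bessel_system : seq (seq sparse) := [seq bessel_row c | c <- bessel_rows].

Section Bessel.

Variables (F : finFieldType) (z : F).
Hypotheses (z11 : z ^+ 11 = 1) (z1 : z != 1).

Definition bessel_cyc : cyc :=
  sparse_dot (bessel_row (1, 0)%N) (cofactors 4 [seq bessel_row c | c <- behead bessel_rows]).

(** The norm of the determinant is 11^14, so it is the 14th power of 1 - z times
    a unit. *)
Lemma bessel_norm : let m := Z.opp (iter 14 (Z.mul (Z.of_nat 11)) (Zpos xH)) in
  rnorm (cabs2 bessel_cyc) = (m, m, m, m, m).
Proof. by vm_compute. Qed.

Lemma bessel_det : \det (sparse_mx z 5 bessel_system) != 0.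
Proof.
have -> : \det (sparse_mx z 5 bessel_system) = cyc_eval z bessel_cyc.
  by rewrite /bessel_cyc (cyc_eval_det z11 (n := 4)) //; move=> [|[|[|[|]]]].
have := bessel_norm; move: bessel_cyc => d nd; apply/eqP=> e.
have := real_eval_norm (cabs2 d) z11 z1; rewrite nd real_eval_cabs2 // e !mul0r real_eval_const // => /eqP.
have -> : Z_cast F (Z.opp (iter 14 (Z.mul (Z.of_nat 11)) (Zpos xH))) = - 11%:R ^+ 14.
  have oppE x : Z.opp x = Z.sub Z0 x by [].
  rewrite oppE Z_castB Z_cast0 sub0r; congr (- _); elim: 14%N => [|n IH]; first exact: Z_cast1.
  by rewrite iterS Z_castM IH Z_cast_nat exprS.
by rewrite opprK expf_eq0 /= (negPf (eleven_neq0 z11 z1)).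
Qed.

Lemma sparse_eval_bessel y t k : (0 < y < 6)%N -> (t < 11)%N -> (0 < k < 6)%N ->
  sparse_eval z (bessel_entry y t k) = chi F (y%:R / k%:R) *
    (psi z (t%:R * (y%:R / k%:R) - (1 + y%:R ^+ 2) / (y%:R / k%:R))
     + psi z (- (t%:R * (y%:R / k%:R)) + (1 + y%:R ^+ 2) / (y%:R / k%:R))).
Proof.
move=> y6 t11 k6.
have modE (n : nat) : (n %% 11)%:R = n%:R :> F11 by apply/eqP; rewrite -val_eqE /= !val_Fp_nat // modn_mod.
have tenE : 10%:R = - 1 :> F11 by apply: val_inj.
rewrite invf_div !F11invP; try lia.
rewrite /sparse_eval big_cons big_seq1 /= -!(psi_nat z11) -mulrDr /chi.
congr (_ ^+ _ * (psi _ _ + psi _ _)).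
- by rewrite /nonsq -natrM val_Fp_nat.
- by rewrite modE !(natrD, natrM) tenE; ring.
by rewrite modE !(natrD, natrM) tenE; ring.
Qed.

Section Uniqueness.

Variable Q : 'M[F11]_2 -> 'M[F]_5.
Hypothesis QM : forall g h, \det g = 1 -> \det h = 1 -> Q (g *m h) = Q g *m Q h.
Hypothesis QN1 : Q (- 1%:M) = 1%:M.
Hypothesis Quni : forall j, Q (unipotent j) = weil z (unipotent j).
Hypothesis Qtor : forall a, a != 0 -> Q (torus a) = weil z (torus a).

Definition oddext (q : 'rV[F]_5) (x : F11) : F :=
  \sum_k q 0 k * ((x == half_point k)%:R - (x == - half_point k)%:R).

Lemma mul_weil_torus (q : 'rV[F]_5) a i : a != 0 ->
  (q *m weil z (torus a)) 0 i = chi F a * oddext q (half_point i / a).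
Proof.
move=> a0; rewrite mxE /oddext mulr_sumr; apply: eq_bigr => k _.
rewrite mxE weil_kernel_mx2 eqxx mulr0 mul0r (psi0 z) mulr1 mulrCA; congr (_ * (_ * _)).
have e (x : F11) : (half_point i == a * x) = (half_point i / a == x).
  by rewrite -(inj_eq (mulfI a0) (half_point i / a)) [a * (_ / _)]mulrC divfK.
by rewrite -mulrN !e.
Qed.

(** If t is not a nonzero square then the projection [coord_proj] at t is zero, and
    so is the corresponding combination of the matrices of the unipotent elements
    u_j, hence also that of the w u_j w for the Weyl element w.  For j != 0 the latter are u_(-1/j) w a_(-j) u_(-1/j) with a torus
    element a, so the top row of this identity is linear in the top row of
    Q w.  (As a function on F_11, this row is the Bessel function of the
    representation.) *)
Lemma bessel_relation (t : F11) (i : 'I_5) : (forall k, half_point k ^+ 2 != t) ->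
  (0 == i)%:R + \sum_(j | j != 0)
    psi z (- (t * j)) * psi z (- (1 + half_point i ^+ 2) / j) * chi F j
      * oddext (row 0 (Q weyl)) (half_point i / j) = 0.
Proof.
move=> ht.
have w2 : weyl *m weyl = - 1%:M by rewrite opp_mx2_1 mulmx2; congr mx2; ring.
have E : \sum_j psi z (- (t * j)) *: Q (weyl *m unipotent j *m weyl) = 0.
  have p0 : coord_proj F t = 0.
    apply/matrixP=> k l; rewrite !mxE (negPf (ht _)); exact: mul0rn.
  transitivity (Q weyl *m (\sum_j psi z (- (t * j)) *: weil z (unipotent j)) *m Q weyl); last first.
    by rewrite sum_weil_unipotent // p0 scaler0 mulmx0 mul0mx.
  rewrite mulmx_sumr mulmx_suml; apply: eq_bigr => j _.
  rewrite !QM ?det_mulmx ?det_unipotent ?det_weyl ?mulr1 // Quni.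
  by rewrite -scalemxAr -scalemxAl.
have := congr1 (fun M : 'M_5 => M 0 i) E; rewrite (bigD1 0) //= [RHS]mxE => e; rewrite -[RHS]e {e}.
rewrite [in RHS]mxE summxE; congr (_ + _).
  have -> : weyl *m unipotent 0 *m weyl = - 1%:M by rewrite /unipotent mx2_1 mulmx1.
  by rewrite QN1 mulr0 oppr0 (psi0 z) scale1r mxE.
apply: eq_bigr => j j0.
have nj0 : - j != 0 by rewrite oppr_eq0.
have -> : weyl *m unipotent j *m weyl = unipotent (- j^-1) *m (weyl *m torus (- j)) *m unipotent (- j^-1).
  by rewrite !mulmx2; congr mx2; field; rewrite ?oppr_eq0 ?j0.
rewrite !QM ?det_mulmx ?det_unipotent ?det_weyl ?det_torus ?mulr1 // Qtor // !Quni !weil_unipotent //.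
rewrite mxE mul_mx_diag mul_diag_mx !mxE half_point0 expr1n mulr1.
have -> : \sum_k Q weyl 0 k * weil z (torus (- j)) k i = (row 0 (Q weyl) *m weil z (torus (- j))) 0 i.
  by rewrite mxE; apply: eq_bigr => k _; rewrite mxE [row 0 _ _ _]mxE.
rewrite mul_weil_torus // chiN // invrN [half_point i * - _]mulrN.
have -> : oddext (row 0 (Q weyl)) (- (half_point i / j)) = - oddext (row 0 (Q weyl)) (half_point i / j).
  rewrite /oddext -sumrN; apply: eq_bigr => k _.
  by rewrite eqr_opp eqr_oppLR -[RHS]mulrN opprB.
have -> : - (1 + half_point i ^+ 2) / j = - j^-1 + - j^-1 * half_point i ^+ 2 by ring.
by rewrite (psiD z11); ring.
Qed.

(** The relation w a_(1/x) = a_x w expresses every row of Q w through the first one. *)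
Lemma row_Q_weyl i : row i (Q weyl) =
  chi F (half_point i) *: (row 0 (Q weyl) *m weil z (torus (half_point i)^-1)).
Proof.
have x0 := half_point_neq0 i; set x := half_point i in x0 *.
have xV0 : x^-1 != 0 by rewrite invr_eq0.
rewrite -Qtor // -row_mul -QM ?det_weyl ?det_torus //.
have -> : weyl *m torus x^-1 = torus x *m weyl by rewrite !mulmx2; congr mx2; rewrite ?invrK; ring.
rewrite QM ?det_weyl ?det_torus // row_mul Qtor //.
have -> : row 0 (weil z (torus x)) = chi F x *: delta_mx 0 i.
  apply/rowP=> k; rewrite !mxE weil_kernel_mx2 eqxx half_point0 mulr0 mul0r (psi0 z) !mulr1.
  by rewrite /x half_point_eq half_point_eqN subr0.
by rewrite -scalemxAl scalerA chi_sqr scale1r -rowE.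
Qed.

End Uniqueness.

(** A representation of PSL(2,11) that agrees with the Weil representation on the
    upper triangular matrices. *)
Definition weil_like (Q : 'M[F11]_2 -> 'M[F]_5) :=
  [/\ forall g h, \det g = 1 -> \det h = 1 -> Q (g *m h) = Q g *m Q h,
      Q (- 1%:M) = 1%:M, forall j, Q (unipotent j) = weil z (unipotent j) &
      forall a, a != 0 -> Q (torus a) = weil z (torus a)].

Lemma weil_like_weil : weil_like (weil z).
Proof. by split=> // [g h|]; [exact: weilM|exact: weilN1]. Qed.

(** Only the first row of the matrix of the Weyl element has to be determined.  The
    difference d of two candidates solves the homogeneous equations of
    [bessel_relation], five of which are independent. *)
Lemma weil_unique Q g : weil_like Q -> \det g = 1 -> Q g = weil z g.
Proof.
move=> Ql; have [QM QN1 Quni Qtor] := Ql; have [WM WN1 Wuni Wtor] := weil_like_weil.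
suff W : Q weyl = weil z weyl.
  move: g; apply: sl2_ind.
  - by rewrite -mx2_1 -[mx2 1 0 0 1]/(unipotent 0) Quni.
  - by move=> g j dg e; rewrite QM ?det_unipotent // WM ?det_unipotent // e Quni.
  - by move=> g dg e; rewrite QM ?det_weyl // WM ?det_weyl // e W.
suff W0 : row 0 (Q weyl) = row 0 (weil z weyl).
  by apply/row_matrixP=> i; rewrite (row_Q_weyl QM Qtor) (row_Q_weyl WM Wtor) W0.
pose d := row 0 (Q weyl) - row 0 (weil z weyl).
apply/eqP; rewrite -subr_eq0 -/d.
have oddB x : oddext d x = oddext (row 0 (Q weyl)) x - oddext (row 0 (weil z weyl)) x.
  by rewrite /oddext -sumrB; apply: eq_bigr => k _; rewrite !mxE mulrBl.
have rel t i : (forall k, half_point k ^+ 2 != t) -> \sum_(j | j != 0)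
    psi z (- (t * j)) * psi z (- (1 + half_point i ^+ 2) / j) * chi F j * oddext d (half_point i / j) = 0.
  move=> ht; under eq_bigr do rewrite oddB mulrBr.
  rewrite sumrB; apply/eqP; rewrite subr_eq0; apply/eqP; apply: (addrI (0 == i)%:R).
  by rewrite (bessel_relation QM QN1 Quni Qtor i ht) (bessel_relation WM WN1 Wuni Wtor i ht).
clearbody d.
suff dM : sparse_mx z 5 bessel_system *m d^T = 0.
  have u : sparse_mx z 5 bessel_system \in unitmx by rewrite unitmxE unitfE bessel_det.
  by rewrite -trmx_eq0 -[d^T](mulKmx u) dM mulmx0.
apply/matrixP=> r c0; rewrite !mxE.
pose c := nth (0, 0)%N bessel_rows r.
(* The i-th half point is the first component of the chosen pair, and minus
   the second one is not a nonzero square. *)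
have [i ci ht] : exists2 i : 'I_5, c.1 = i.+1 & forall k, half_point k ^+ 2 != - c.2%:R :> F11.
  rewrite /c {c}; case: r => [[|[|[|[|[|//]]]]]] /= _;
    [exists 0|exists 0|exists 0|exists 0|exists ord_max] => //;
    by case=> [[|[|[|[|[|//]]]]]].
have c2 : (c.2 < 11)%N by rewrite /c; case: r {c ci ht} => [[|[|[|[|[|//]]]]]].
rewrite -[RHS](rel _ i ht); set y := half_point i.
under [RHS]eq_bigr do rewrite /oddext mulr_sumr.
rewrite exchange_big /=; apply: eq_bigr => k _; rewrite !mxE (ord1 c0).
have -> : nth [::] (nth [::] bessel_system r) k = bessel_entry c.1 c.2 k.+1.
  rewrite (nth_map (0, 0)%N) ?ltn_ord // -/c /bessel_row (nth_map 0%N) ?size_iota ?ltn_ord //.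
  by rewrite nth_iota ?ltn_ord.
have y0 : y != 0 := half_point_neq0 i; have x0 := half_point_neq0 k.
have i6 : (0 < i.+1 < 6)%N by have := ltn_ord i; lia.
have k6 : (0 < k.+1 < 6)%N by have := ltn_ord k; lia.
rewrite ci sparse_eval_bessel // -/(half_point i) -/(half_point k) -/y; set x := half_point k in x0 *.
pose f j := psi z (- (- c.2%:R * j)) * psi z (- (1 + y ^+ 2) / j) * chi F j.
transitivity (d 0 k * (f (y / x) - f (- (y / x)))).
  have a0 : y / x != 0 by rewrite mulf_neq0 ?invr_eq0.
  rewrite /f chiN // -!(psiD z11) mulrC invrN; congr (_ * _).
  rewrite mulrN opprK mulrC -mulrDl; congr ((_ + _) * _); congr psi; ring.
have delta a : a != 0 -> \sum_(j | j != 0) f j * (j == a)%:R = f a.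
  move=> a0; rewrite (bigD1 a) //= eqxx mulr1 big1 ?addr0 // => j /andP[_ /negPf ->].
  by rewrite mulr0.
rewrite -!delta ?oppr_eq0 ?mulf_neq0 ?invr_eq0 // -sumrB mulr_sumr; apply: eq_bigr => j j0.
have e (v : F11) : v != 0 -> (y / j == v) = (j == y / v).
  move=> v0; rewrite -(inj_eq (mulIf j0)) divfK // -(inj_eq (mulIf v0) j) divfK // eq_sym.
  by rewrite mulrC.
rewrite -mulrBr mulrCA -/(f j) e // e ?oppr_eq0 // invrN mulrN.
ring.
Qed.

End Bessel.

(** * Every transitive 60-arc comes from the Weil representation *)

Lemma map_uniq_inj (T1 T2 : eqType) (f : T1 -> T2) s :
  uniq [seq f x | x <- s] -> {in s &, injective f}.
Proof.
elim: s => [//|x s IH] /= /andP[fx /IH{}IH] y t; rewrite !inE.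
case/predU1P=> [->|ys] /predU1P[->|ts] // e; last exact: IH.
  by rewrite e map_f in fx.
by rewrite -e map_f in fx.
Qed.

Section Converse.

Variable F : finFieldType.
Variable rH : mx_representation F (PSLgroup 2 F11) 5.
Variable A : {set {vspace 'rV[F]_5}}.
Hypothesis arcA : is_arc 60 A.
Hypothesis actsA : [acts proj_image rH, on A | PGL_action F].
Hypothesis transA : [transitive proj_image rH, on A | PGL_action F].

Local Notation R := (slrep rH).

Lemma cardA : #|A| = 60%N. Proof. by case: arcA. Qed.

Lemma linact_in g U : \det g = 1 -> U \in A -> linact (R g) U \in A.
Proof.
by move=> dg UA; rewrite -proj_lift_act // (acts_act actsA) // proj_lift_in.
Qed.

Lemma linact_trans U V : U \in A -> V \in A -> exists2 g, \det g = 1 & linact (R g) U = V.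
Proof.
move=> UA VA; have dom : proj_image rH \subset ([set: {'GL_5[F]}] / 'Z('GL_5[F]))%g.
  by apply/subsetP => x _; have [y _ ->] := cosetP x; apply: mem_quotient; rewrite inE.
have := atransPin dom transA UA => /setP/(_ V); rewrite VA => /orbitP[x xG <-].
by have [g dg ->] := proj_image_act xG; exists g.
Qed.

(** The number of fixed points of a group of order 1 or 11 is congruent to 60, hence
    nonzero, modulo 11. *)
Lemma unipotent_fixes_point : exists2 U, U \in A & linact (R (unipotent 1)) U = U.
Proof.
pose x := proj_lift rH (unipotent 1).
have p11 : (11.-group <[x]>)%g.
  rewrite /pgroup -orderE; apply: pnat_dvd (pnat_id (isT : prime 11)).
  rewrite order_dvdn -proj_lift_unipotentX (_ : 11%:R = 0); last exact: val_inj.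
  by rewrite [unipotent _]mx2_1 proj_lift1.
have actsX : [acts <[x]>%g, on A | PGL_action F].
  apply: subset_trans actsA; rewrite cycle_subG; exact: proj_lift_in (det_unipotent 1).
have := pgroup_fix_mod p11 actsX; rewrite cardA.
have [->|[U]] := set_0Vmem 'Fix_(A | PGL_action F)(<[x]>)%g; first by rewrite cards0.
case/setIP=> UA /afixP/(_ x (cycle_id x)) xU _.
by exists U; rewrite // -proj_lift_act ?det_unipotent.
Qed.

Lemma point_line U : U \in A -> exists2 v, v != 0 & U = <[v]>%VS.
Proof.
case: arcA => pts _ _ /pts/eqP dU; have U0 : U != 0%VS by rewrite -dimv_eq0 dU.
exists (vpick U); first by rewrite vpick0.
apply/eqP; rewrite eq_sym eqEdim -memvE memv_pick dim_vline vpick0 U0 dU //.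
Qed.

(** Otherwise the five points lie in a hyperplane. *)
Lemma arc_det_neq0 (M : 'M[F]_5) : injective (fun i => <[row i M]>%VS) ->
  (forall i, <[row i M]>%VS \in A) -> \det M != 0.
Proof.
move=> injM MA; apply/eqP=> /hyperplane_rowspace[H dH hH].
case: arcA => _ _ /(_ [set <[row i M]>%VS | i : 'I_5]); case.
- by apply/subsetP=> _ /imsetP[i _ ->].
- by rewrite card_imset // card_ord.
exists H; first by apply/eqP.
by move=> _ /imsetP[i _ ->]; rewrite -memvE.
Qed.

Section FixedPoint.

Variable v : 'rV[F]_5.
Hypothesis v0 : v != 0.
Hypothesis vA : <[v]>%VS \in A.
Hypothesis v_fix : linact (R (unipotent 1)) <[v]>%VS = <[v]>%VS.

(** The unipotent subgroup is generated by its element with j = 1, and has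
    exponent 11. *)
Lemma eigen : exists2 z : F, z ^+ 11 = 1 & forall j, v *m R (unipotent j) = psi z j *: v.
Proof.
have : v *m R (unipotent 1) \in <[v]>%VS by rewrite -v_fix linact_line memv_line.
move=> /vlineP[z vz].
have vn n : v *m R (unipotent n%:R) = z ^+ n *: v.
  elim: n => [|n IH]; first by rewrite /unipotent mx2_1 slrep1 mulmx1 expr0 scale1r.
  have -> : unipotent n.+1%:R = unipotent n%:R *m unipotent 1 by rewrite mulmx2 -natr1; congr mx2; ring.
  by rewrite slrepM ?det_unipotent // mulmxA IH -scalemxAl vz scalerA -exprSr.
have z11 : z ^+ 11 = 1.
  have := vn 11; have -> : 11%:R = 0 :> F11 by apply: val_inj.
  rewrite /unipotent mx2_1 slrep1 mulmx1 => e.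
  have : (z ^+ 11 - 1) *: v == 0 by rewrite scalerBl -e scale1r subrr.
  by rewrite scaler_eq0 (negPf v0) orbF subr_eq0 => /eqP.
by exists z => // j; rewrite -vn natr_Zp.
Qed.

Lemma slrepN g : \det g = 1 -> R (- g) = R g.
Proof.
by move=> dg; rewrite -mulN1r -mulmxE slrepM ?det_oppr2 // slrepN1 mul1mx.
Qed.

(** Matrices of determinant 1 with the same second row differ by a unipotent factor
    on the left, which fixes the line of v, and minus the identity acts
    trivially. *)
Lemma same_row g h : \det g = 1 -> \det h = 1 -> row 1 g = row 1 h \/ row 1 g = - row 1 h ->
  <[v *m R g]>%VS = <[v *m R h]>%VS.
Proof.
have det_opp (k : 'M[F11]_2) : \det (- k) = \det k.
  by rewrite -scaleN1r detZ sqrrN expr1n mul1r.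
have same g' h' : \det g' = 1 -> \det h' = 1 -> row 1 g' = row 1 h' ->
    <[v *m R g']>%VS = <[v *m R h']>%VS.
  move=> dg dh e.
  have -> : g' = unipotent (g' 0 1 * h' 0 0 - g' 0 0 * h' 0 1) *m h'.
    move: dg dh; have := congr1 (fun r : 'rV_2 => r 0 0) e; have := congr1 (fun r : 'rV_2 => r 0 1) e.
    rewrite !mxE [g']mx2E [h']mx2E; move: (g' 0 0) (g' 0 1) (g' 1 0) (g' 1 1) => a b c d.
    move: (h' 0 0) (h' 0 1) (h' 1 0) (h' 1 1) => a' b' c' d'.
    rewrite !mxE /= !det_mx2 mulmx2 => -> -> dg dh.
    congr mx2; rewrite ?mul0r ?add0r ?mul1r //.
      transitivity (a * (a' * d' - b' * c')); first by rewrite dh mulr1.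
      by transitivity (a' * (a * d' - b * c') + (b * a' - a * b') * c'); [ring|rewrite dg mulr1].
    transitivity (b * (a' * d' - b' * c')); first by rewrite dh mulr1.
    by transitivity (b' * (a * d' - b * c') + (b * a' - a * b') * d'); [ring|rewrite dg mulr1].
  rewrite slrepM ?det_unipotent // mulmxA; have [z z11 ->] := eigen.
  by rewrite -scalemxAl vline_scale // psi_neq0.
move=> dg dh [e|e]; first exact: same.
rewrite -(slrepN dh); apply: same; rewrite ?det_opp // e.
by apply/rowP=> j; rewrite !mxE.
Qed.

Definition lift_row (w : 'rV[F11]_2) : 'M[F11]_2 :=
  odflt 1%:M [pick g | (\det g == 1) && (row 1 g == w)].

Lemma lift_rowP w : w != 0 -> \det (lift_row w) = 1 /\ row 1 (lift_row w) = w.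
Proof.
move=> w0; have [g dg gw] := complete_row1 w0; rewrite /lift_row.
case: pickP => [h /andP[/eqP-> /eqP->] //|/(_ g)]; by rewrite dg gw !eqxx.
Qed.

Definition arc_point (w : 'rV[F11]_2) : {vspace 'rV[F]_5} := <[v *m R (lift_row w)]>%VS.

Lemma arc_point_row g : \det g = 1 -> <[v *m R g]>%VS = arc_point (row 1 g).
Proof.
move=> dg; have g0 := row1_neq0 dg.
by have [dl rl] := lift_rowP g0; apply: same_row => //; left.
Qed.

Lemma arc_point_in w : w != 0 -> arc_point w \in A.
Proof.
by move=> w0; have [dl _] := lift_rowP w0; rewrite /arc_point -linact_line linact_in.
Qed.

Lemma arc_point_pm w w' : w != 0 -> w = w' \/ w = - w' -> arc_point w = arc_point w'.
Proof.
move=> w0 e; have w'0 : w' != 0.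
  by case: e => e; rewrite -?e // -oppr_eq0 -e.
have [dl rl] := lift_rowP w0; have [dl' rl'] := lift_rowP w'0.
by apply: same_row => //; rewrite rl rl'.
Qed.

Lemma arc_sub_points : {subset A <= [seq arc_point (pair_row u) | u <- half_plane]}.
Proof.
move=> U UA; have [g dg <-] := linact_trans vA UA; rewrite linact_line arc_point_row //.
have g0 := row1_neq0 dg.
have [u hu e] := half_plane_repr g0; apply/mapP; exists u; first by [].
exact: arc_point_pm.
Qed.

(** The 60 vectors of the half plane are mapped onto the 60 points of A. *)
Lemma arc_point_inj w w' : w != 0 -> w' != 0 -> arc_point w = arc_point w' -> w = w' \/ w = - w'.
Proof.
have U : uniq [seq arc_point (pair_row u) | u <- half_plane].
  apply: (leq_size_uniq (enum_uniq A)).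
    by move=> W; rewrite mem_enum; apply: arc_sub_points.
  by rewrite -cardE cardA size_map.
move=> w0 w'0; have [u hu e] := half_plane_repr w0; have [u' hu' e'] := half_plane_repr w'0.
rewrite (arc_point_pm w0 e) (arc_point_pm w'0 e') => E.
have uu : u = u' by exact: (map_uniq_inj U) hu hu' E.
by rewrite uu in e; case: e => ->; case: e' => ->; rewrite ?opprK; [left|right|right|left].
Qed.

Variable z : F.
Hypotheses (z11 : z ^+ 11 = 1) (zE : forall j, v *m R (unipotent j) = psi z j *: v).

(** The sign makes this an odd function of x, as the unit vectors of the Weil
    representation are. *)
Definition torus_vec (x : F11) : 'rV[F]_5 := chi F x *: (v *m R (torus x)).

Definition torus_basis : 'M[F]_5 := \matrix_i torus_vec (half_point i).

Lemma row_torus x : row 1 (torus x) = row2 0 x^-1.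
Proof. by apply/eqP/rV2P; rewrite !mxE. Qed.

(** Its rows span five distinct points of the arc. *)
Lemma torus_basis_unit : torus_basis \in unitmx.
Proof.
have line i : <[row i torus_basis]>%VS = arc_point (row2 0 (half_point i)^-1).
  by rewrite rowK (vline_scale _ (chi_neq0 F _)) (arc_point_row (det_torus (half_point_neq0 i))) row_torus.
have r0 i : row2 0 (half_point i)^-1 != 0.
  by apply/negP=> /rV2P[_]; rewrite !mxE /= => /eqP; rewrite invr_eq0 (negPf (half_point_neq0 i)).
rewrite unitmxE unitfE; apply: arc_det_neq0 => [i k|i]; last by rewrite line arc_point_in.
rewrite !line => /(arc_point_inj (r0 i) (r0 k)) e; apply/eqP; rewrite -half_point_eq; apply/eqP/invr_inj.
have v1 (x : F11) : row2 0 x 0 1 = x by rewrite mxE.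
case: e => /(congr1 (fun r : 'rV_2 => r 0 1)); rewrite v1; first by rewrite v1.
rewrite mxE v1 -invrN => /invr_inj/eqP; by rewrite half_point_eqN.
Qed.

Lemma torus_vecN x : x != 0 -> torus_vec (- x) = - torus_vec x.
Proof.
move=> x0; rewrite /torus_vec; have -> : torus (- x) = - torus x.
  by rewrite /torus invrN; apply/matrixP=> i j; rewrite !mxE; case: eqP; case: eqP; rewrite ?oppr0.
by rewrite (slrepN (det_torus x0)) (chiN F x0) scaleNr.
Qed.

Lemma torus_vec1 : torus_vec 1 = v.
Proof.
rewrite /torus_vec; have -> : torus 1 = 1%:M by rewrite /torus invr1 mx2_1.
by rewrite slrep1 mulmx1 chi1 scale1r.
Qed.

Lemma torus_vec_unipotent x j : x != 0 -> torus_vec x *m R (unipotent j) =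
  psi z (j * x ^+ 2) *: torus_vec x.
Proof.
move=> x0; rewrite /torus_vec -scalemxAl -mulmxA -(slrepM rH (det_torus x0) (det_unipotent j)).
have -> : torus x *m unipotent j = unipotent (j * x ^+ 2) *m torus x.
  by rewrite !mulmx2; congr mx2; field.
transitivity (chi F x *: (psi z (j * x ^+ 2) *: (v *m R (torus x)))); last first.
  by rewrite !scalerA mulrC.
congr (_ *: _); rewrite (slrepM rH (det_unipotent _) (det_torus x0)) mulmxA scalemxAl.
by congr (_ *m _); exact: zE.
Qed.

Lemma torus_vec_torus x a : x != 0 -> a != 0 -> torus_vec x *m R (torus a) = chi F a *: torus_vec (a * x).
Proof.
move=> x0 a0; have ax0 : a * x != 0 by rewrite mulf_neq0.
rewrite /torus_vec -scalemxAl -mulmxA -(slrepM rH (det_torus x0) (det_torus a0)).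
have -> : torus x *m torus a = torus (a * x).
  by rewrite mulmx2; congr mx2; field; rewrite ?a0 ?x0.
by rewrite /torus_vec (chiM F a0 x0) scalerA mulrA chi_sqr mul1r.
Qed.

Lemma torus_basis_unipotent j : torus_basis *m R (unipotent j) = weil z (unipotent j) *m torus_basis.
Proof.
apply/row_matrixP=> i; rewrite !row_mul rowK (torus_vec_unipotent _ (half_point_neq0 i)).
by rewrite weil_unipotent // row_diag_mx mxE -scalemxAl -rowE rowK.
Qed.

Lemma torus_basis_torus a : a != 0 -> torus_basis *m R (torus a) = weil z (torus a) *m torus_basis.
Proof.
move=> a0; apply/row_matrixP=> i; rewrite !row_mul rowK (torus_vec_torus (half_point_neq0 i) a0).
have ax0 : a * half_point i != 0 by rewrite mulf_neq0 ?half_point_neq0.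
have row_w k e : (forall l, weil_kernel z (torus a) (half_point i) (half_point l) = e * (l == k)%:R) ->
    row i (weil z (torus a)) *m torus_basis = e *: torus_vec (half_point k).
  move=> h; have -> : row i (weil z (torus a)) = e *: delta_mx 0 k.
    by apply/rowP=> l; rewrite !mxE h eqxx.
  by rewrite -scalemxAl -rowE rowK.
have [k e] := half_pointP ax0; symmetry; case: e => e; rewrite e ?(torus_vecN (half_point_neq0 k)).
  apply: row_w => l; rewrite weil_kernel_mx2 eqxx mulr0 mul0r (psi0 z) mulr1 e.
  by rewrite half_point_eq half_point_eqN subr0.
rewrite scalerN -scaleNr; apply: row_w => l.
rewrite weil_kernel_mx2 eqxx mulr0 mul0r (psi0 z) mulr1 e opprK half_point_eq half_point_eqN sub0r.
by rewrite mulrN mulNr.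
Qed.

(** Otherwise the unipotent subgroup would act trivially, but it moves points
    of A. *)
Lemma eigen_neq1 : z != 1.
Proof.
apply/eqP=> e; have R1 : R (unipotent 1) = 1%:M.
  apply: (can_inj (mulKmx torus_basis_unit)); rewrite torus_basis_unipotent mulmx1.
  rewrite weil_unipotent //;
  suff -> : diag_mx (\row_i psi z (1 * half_point i ^+ 2)) = 1%:M by rewrite mul1mx.
  by apply/matrixP=> i j; rewrite !mxE /psi e expr1n.
pose g := mx2 0 (- 1) 1 0 : 'M[F11]_2.
have dg : \det g = 1 by rewrite det_mx2; ring.
have dgu : \det (g *m unipotent 1) = 1 by rewrite det_mulmx dg det_unipotent mulr1.
have g0 := row1_neq0 dg; have gu0 := row1_neq0 dgu.
have E : arc_point (row 1 (g *m unipotent 1)) = arc_point (row 1 g).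
  by rewrite -(arc_point_row dgu) -(arc_point_row dg) (slrepM rH dg (det_unipotent 1)) R1 mulmx1.
by case: (arc_point_inj gu0 g0 E) => /eqP/rV2P; rewrite mulmx2 !mxE /= => -[].
Qed.

Lemma weil_like_slrep : weil_like z (fun g => torus_basis *m R g *m invmx torus_basis).
Proof.
have u := torus_basis_unit; split=> [g h dg dh||j|a a0].
- by rewrite (slrepM rH dg dh) !mulmxA mulmxKV.
- by rewrite slrepN1 mulmx1 mulmxV.
- by rewrite torus_basis_unipotent mulmxK.
by rewrite (torus_basis_torus a0) mulmxK.
Qed.

(** In the basis of torus translates of v the representation is the Weil
    representation, and v is the first unit vector. *)
Lemma arc_point_weil w : w != 0 -> arc_point w = <[point_vec z w *m torus_basis]>%VS.
Proof.
move=> w0; have [dl rl] := lift_rowP w0; have z1 := eigen_neq1.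
have v_row : v = row 0 torus_basis by rewrite rowK half_point0 torus_vec1.
rewrite /arc_point {1}v_row -row_mul.
have -> : torus_basis *m R (lift_row w) = weil z (lift_row w) *m torus_basis.
  by rewrite -(weil_unique z11 z1 weil_like_slrep dl) mulmxKV ?torus_basis_unit.
rewrite row_mul (row0_weil z11 dl) rl -scalemxAl; apply: vline_scale.
exact: weil_scale_neq0.
Qed.

Lemma det_points_mx_neq0 s : size s = 5%N -> 0 \notin s -> pairwise pmdiff s -> \det (points_mx z s) != 0.
Proof.
move=> s5 s0 s_pm; suff : \det (points_mx z s *m torus_basis) != 0.
  by rewrite det_mulmx mulf_eq0 negb_or => /andP[].
have si (i : 'I_5) : nth 0 s i != 0 := nth_neq0 s5 s0 (ltn_ord i).
have line i : <[row i (points_mx z s *m torus_basis)]>%VS = arc_point (nth 0 s i).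
  by rewrite row_mul rowK (arc_point_weil (si i)).
apply: arc_det_neq0 => [i k|i]; last by rewrite line; exact: arc_point_in (si i).
rewrite !line => /(arc_point_inj (si i) (si k)) e; apply: val_inj.
exact: (nth_pm_inj s5 s_pm (ltn_ord i) (ltn_ord k) e).
Qed.

End FixedPoint.

(** The powers z^k are covered too: by [point_vec_galois] they amount to applying
    diag(1/k, 1) to the five vectors. *)
Lemma arc_root : exists2 z : F, z ^+ 11 = 1 /\ z != 1 &
  forall k s, k%:R != 0 :> F11 -> size s = 5%N -> 0 \notin s -> pairwise pmdiff s ->
  \det (points_mx (z ^+ k) s) != 0.
Proof.
have [U UA Ufix] := unipotent_fixes_point; have [v v0 Uv] := point_line UA.
rewrite Uv in UA Ufix; have [z z11 zE] := eigen v0 Ufix.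
have z1 := eigen_neq1 v0 UA Ufix zE.
exists z => // k s k0 s5 s0 s_pm.
pose g := mx2 (k%:R)^-1 0 0 1 : 'M[F11]_2.
have gu : g \in unitmx by rewrite unitmxE unitfE det_mx2 mulr1 mulr0 subr0 invr_eq0.
have -> : points_mx (z ^+ k) s = points_mx z [seq w *m g | w <- s].
  apply/row_matrixP=> i; rewrite !rowK (nth_map 0) ?s5 // point_vec_galois //.
apply: (det_points_mx_neq0 v0 UA Ufix z11 zE).
- by rewrite size_map.
- apply/negP=> /mapP[w ws /esym e]; case/negP: s0.
  by rewrite -(mulmxK gu w) e mul0mx in ws.
rewrite pairwise_map; apply: sub_pairwise s_pm => x y /= /andP[xy xNy].
by rewrite /pmdiff -mulNmx !(can_eq (mulmxK gu)) xy.
Qed.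

End Converse.

(** * The primes for which an arc exists *)

(** The order 11 of z divides p - 1, because the exponents 11 and p - 1 would
    otherwise be coprime. *)
Lemma root_mod11 p (z : 'F_p) : prime p -> z ^+ 11 = 1 -> z != 1 -> p = 1 %[mod 11].
Proof.
move=> pp z11 z1; have p0 := prime_gt0 pp.
suff d : (11 %| p.-1)%N by apply/eqP; rewrite eqn_mod_dvd // subn1.
apply: contraNT z1 => nd; have co : coprime 11 p.-1 by rewrite prime_coprime.
have z0 : z != 0.
  by apply/eqP=> z0; move/eqP: z11; rewrite z0 expr0n /= eq_sym oner_eq0.
have zp : z ^+ p.-1 = 1.
  apply: (mulfI z0); rewrite -exprS mulr1 prednK //.
  by have := expf_card z; rewrite card_Fp.
have [u v e _] := egcdnP p.-1 (isT : 0 < 11)%N.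
rewrite (eqP co) in e.
have : z ^+ (u * 11) = z by rewrite e addn1 exprSr mulnC exprM zp expr1n mul1r.
by rewrite mulnC exprM z11 expr1n => <-.
Qed.

(** The group of units has order p - 1, so Cauchy's theorem applies. *)
Lemma mod11_root p : prime p -> p = 1 %[mod 11] -> exists2 z : 'F_p, z ^+ 11 = 1 & z != 1.
Proof.
move=> pp p1; have d : (11 %| #|[set: {unit 'F_p}]|)%N.
  by rewrite card_finField_unit card_Fp // -subn1 -eqn_mod_dvd ?prime_gt0 // p1.
have [x _ ox] := Cauchy (isT : prime 11) d; exists (FinRing.uval x).
  by rewrite -FinRing.val_unitX -ox expg_order.
apply/eqP=> e; have x1 : x = 1%g by apply: val_inj.
by rewrite x1 order1 in ox.
Qed.

Lemma arc_exists p : prime p -> p = 1 %[mod 11] -> (11903 < p)%N \/ p \in exceptional_primes ->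
  exists A : {set {vspace 'rV['F_p]_5}}, is_arc 60 A /\ PSL211_transitive A.
Proof.
move=> pp p1 hp; have [z z11 z1] := mod11_root pp p1.
exists (weil_orbit z11 z1); split; last exact: weil_orbit_transitive.
apply: weil_orbit_arc => y a b c y11 y1 h; exact: normal_det_neq0.
Qed.

Lemma normal_five_pmdiff a b c : subseq [:: a; b; c] half_rest ->
  pairwise pmdiff (normal_five a b c) /\ 0 \notin normal_five a b c.
Proof.
move=> h; pose us := [:: (0, 1); c; (1, 0); a; b]%N.
have perm : perm_eq us [:: (0, 1), (1, 0) & [:: a; b; c]]%N.
  apply/seq.permP=> P; rewrite /=; lia.
have n1 : (0, 1)%N \notin half_rest by vm_compute.
have n2 : (1, 0)%N \notin half_rest by vm_compute.
have Uo : uniq half_rest by vm_compute.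
have hin v : v \in [:: a; b; c] -> v \in half_rest by move/(mem_subseq h).
have Uus : uniq us.
  rewrite (perm_uniq perm); apply/and3P; split; last exact: subseq_uniq h Uo.
    by apply/negP; case/predU1P => // /hin; apply/negP.
  by apply/negP=> /hin; apply/negP.
have hus : {subset us <= half_plane}.
  move=> v; rewrite (perm_mem perm); case/predU1P=> [->|]; first by vm_compute.
  by case/predU1P=> [->|/hin/half_rest_half]; first by vm_compute.
split; first exact: half_plane_pmdiff.
by apply/negP=> /mapP[u /hus/pair_row_neq0/eqP nz /esym].
Qed.

(** If p were bad, some conjugate of a determinant in normal form would vanish,
    against [arc_root]. *)
Lemma arc_only_if p : prime p ->
  (exists A : {set {vspace 'rV['F_p]_5}}, is_arc 60 A /\ PSL211_transitive A) ->
  p = 1 %[mod 11] /\ ((11903 < p)%N \/ p \in exceptional_primes).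
Proof.
move=> pp [A [arcA [G [_ [rH _ ->] actsA transA]]]].
have [z [z11 z1] dets] := arc_root arcA actsA transA.
have p1 := root_mod11 pp z11 z1; split=> //.
case: (leqP p 11903) => [small|]; last by left.
case pe: (p \in exceptional_primes); first by right.
have pb := small_bad pp p1 small (negbT pe).
have [a [b [c [h [k k0 d0]]]]] := bad_det_eq0 pp pb z11 z1.
have [h1 h2] := normal_five_pmdiff h.
by have := dets k (normal_five a b c) k0 erefl h2 h1; rewrite d0 eqxx.
Qed.

(** Take m = 11 N! and a prime divisor p of 1 + m + ... + m^10.  It does not divide
    m, so p > N, and m is an 11th root of unity modulo p, different from 1 since
    p is not 11. *)
Lemma infinite_primes_mod11 N : exists p, [/\ (N < p)%N, prime p & p = 1 %[mod 11]].
Proof.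
pose m := (11 * N`!)%N; pose q := (\sum_(i < 11) m ^ i)%N.
have m0 : (0 < m)%N by rewrite muln_gt0 fact_gt0.
have qE : q = (1 + m * \sum_(i < 10) m ^ i)%N.
  rewrite /q big_ord_recl expn0 big_distrr; congr (_ + _)%N.
  by apply: eq_bigr => i _; rewrite lift0 expnS.
have q1 : (1 < q)%N.
  by rewrite qE -[X in (X < _)%N]addn0 ltn_add2l muln_gt0 m0 big_ord_recl expn0.
pose p := pdiv q; have pp : prime p := pdiv_prime q1.
have pm : ~~ (p %| m)%N.
  apply/negP=> pm; have : (p %| q)%N := pdiv_dvd q.
  rewrite [X in (_ %| X)%N]qE (dvdn_addl _ (dvdn_mulr _ pm)) dvdn1 => /eqP p1.
  by rewrite p1 in pp.
have z11 : (m%:R : 'F_p) ^+ 11 = 1.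
  apply/eqP; rewrite -subr_eq0 subrX1 mulf_eq0; apply/orP; right.
  have := pdiv_dvd q; rewrite -/p (dvdn_pcharf (pchar_Fp pp)) natr_sum => /eqP e.
  by rewrite -[X in _ == X]e; apply/eqP/eq_bigr => i _; rewrite natrX.
have z1 : (m%:R : 'F_p) != 1.
  apply/eqP=> e; have := pdiv_dvd q; rewrite -/p (dvdn_pcharf (pchar_Fp pp)) natr_sum.
  under eq_bigr do rewrite natrX e expr1n.
  rewrite sumr_const card_ord -(dvdn_pcharf (pchar_Fp pp)) => p11.
  by case/negP: pm; rewrite dvdn_mulr.
exists p; split=> //; last exact: root_mod11 pp z11 z1.
rewrite ltnNge; apply: contra pm => pN; apply: dvdn_mull.
by rewrite dvdn_fact // prime_gt0.
Qed.

Theorem theorem1p3 :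
  (forall N : nat, exists p : nat,
     [/\ (N < p)%N, prime p &
         exists A : {set {vspace 'rV['F_p]_5}},
           is_arc 60 A /\ PSL211_transitive A])
  /\
  (forall p : nat, prime p ->
     ((exists A : {set {vspace 'rV['F_p]_5}},
         is_arc 60 A /\ PSL211_transitive A)
      <->
      ((p = 1 %[mod 11] /\ (11903 < p)%N) \/ p \in exceptional_primes))).
Proof.
split=> [N|p pp].
  have [p [Np pp p1]] := infinite_primes_mod11 (maxn N 11903).
  move: Np; rewrite gtn_max => /andP[Np bp].
  by exists p; split=> //; apply: arc_exists => //; left.
split=> [/(arc_only_if pp)[p1 [big|exc]]|[[p1 big]|exc]].
- by left.
- by right.
- by apply: arc_exists => //; left.
apply: arc_exists => //; [exact: exceptional_mod11|by right].
Qed.
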